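(* Let $q$ be a prime power and $n,k$ positive integers. The family $\mathcal G_2$ has the largest diversity among intersecting families $\mathcal F\subset\mathcal V_n^k$ of $k$-subspaces (that is, $\gamma(\mathcal F)\le\gamma(\mathcal G_2)$ for every intersecting $\mathcal F\subset \mathcal V_n^k$) whenever one of the following holds: (1) $k = 2$, $n \geq 2k$; (2) $k = 3$, $n \geq 2k+1$; (3) $q\ge 5$, $k\ge 4$, $n\ge 2k+2$; (4) $q=4$, $k\ge 6$, $n\ge 2k+2$; (5) $q=3$, $k\ge 9$, $n\ge 2k+2$; (6) $q=3$, $n\ge 2k+3$, $n-k\ge 9$; (7) $q=2$, $k\ge 4$, $n\ge 2k+3$, $n-k\ge 13$. Furthermore, if $q \geq 7$, $k \geq 4$, $n \geq 2k+2$, then any intersecting family $\mathcal F\subset\mathcal V_n^k$ that is not contained in a family of the form $\mathcal G_2$ (for any choice of the defining $3$-subspace) has diversity at most $2q^{-1} \gamma(\mathcal G_2)$.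
   Context: $V(n,q)$ is the $n$-dimensional vector space over the field with $q$ elements and $\mathcal V_n^k$ is the family of all its $k$-dimensional subspaces. A family of subspaces is intersecting if any two of its members intersect in a subspace of dimension at least $1$. The diversity $\gamma(\mathcal F)$ is the number of members of $\mathcal F$ that do not contain the most popular $1$-dimensional subspace, i.e. $\gamma(\mathcal F)=|\mathcal F|-\max_{P\in \mathcal V_n^1}|\{F\in\mathcal F: P\subset F\}|$. The family $\mathcal G_2$ is $\{F\in \mathcal V_n^k: \dim(F\cap X)\ge 2\}$ for a fixed $3$-dimensional subspace $X$ of $V(n,q)$; its diversity does not depend on the choice of $X$. *)

(* Defs.v *)
From HB Require Import structures.
From mathcomp Require Import all_boot all_order all_algebra.

Set Implicit Arguments.
Unset Strict Implicit.
Unset Printing Implicit Defensive.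

Import VectorInternalTheory. (* subType instance of {vspace V} *)

(* Over a finite field, the subspaces of V form a finite type, so that families
   of subspaces are terms of type {set {vspace V}}. *)
HB.instance Definition _ (F : finFieldType) (V : vectType F) :=
  [Countable of {vspace V} by <:].
HB.instance Definition _ (F : finFieldType) (V : vectType F) :=
  [Finite of {vspace V} by <:].

Section Families.

Variables (F : finFieldType) (V : vectType F).
Implicit Types (A : {set {vspace V}}) (P U W X : {vspace V}).

Definition subspaces (k : nat) : {set {vspace V}} := [set U | \dim U == k].

(* U = W is allowed: this adds no constraint on families of k-subspaces
   with k > 0. *)
Definition intersecting A : Prop :=
  forall U W, U \in A -> W \in A -> 1 <= \dim (U :&: W).

(* The truncated subtraction is exact, since each degree is at most #|A|. *)
Definition diversity A : nat :=
  #|A| - \max_(P in subspaces 1) #|[set U in A | (P <= U)%VS]|.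

Definition G2 (k : nat) X : {set {vspace V}} :=
  [set U in subspaces k | 2 <= \dim (U :&: X)].

End Families.

(* Main.v *)
Require Import Defs.
From mathcomp Require Import all_boot all_order all_algebra all_field.
From mathcomp Require Import zify ring lra.

Set Implicit Arguments.
Unset Strict Implicit.
Unset Printing Implicit Defensive.

Import GRing.Theory Num.Theory Order.TTheory.

(** Points, lines and planes are the subspaces of dimension 1, 2 and 3. The
    diversity of A is the minimum, over the points P, of the number of members of
    A that miss P. It is therefore monotone in A, and to bound it from above it
    suffices to exhibit one good P.
    Write q for the order of the field, [npt d] for the number of points of a
    d-space, and [thru i k] for the number of k-spaces through a given i-space.

    For the family G2 of a 3-space Y, a member that misses a point P of Y meets Y
    exactly in one of the q^2 lines of Y off P, and for each such line there are
    [thru 2 k - thru 3 k] of them. A point outside Y is missed by even more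
    members, so the diversity is q^2 ([thru 2 k] - [thru 3 k])
    ([diversity_G2_le], [diversity_G2_ge]).

    For k >= 4 the family A is peeled ([peeling]). For i going down from k to 2,
    fix a maximal pairwise intersecting family C_i of subspaces of dimension at
    most i, with C_k containing A and C_(i-1) containing the members of C_i of
    dimension below i. By maximality a proper nonzero subspace of a minimal
    member of C_i is disjoint from some member of C_i; choosing points one after
    the other in such disjoint members shows that C_i has at most (npt i)^i
    minimal members of dimension i ([card_minimal]). So at most the sum over
    3 <= i <= k of (npt i)^i [thru i k] members of A contain no member of C_2.
    Now C_2 consists of pairwise intersecting subspaces of dimension at most 2,
    so either all of them contain one point P, or all are lines of one 3-space Y
    ([lines_concurrent_or_coplanar]). In the first case the members of A missing
    P are among those lost in the peeling. In the second case, if A is not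
    contained in the G2 of Y, a member U0 of A with dim (U0 :&: Y) <= 1 is
    available, and P is chosen in Y and containing U0 :&: Y; a surviving member
    that misses P contains one of q^2 lines together with a point of U0 outside
    Y ([diversity_not_in_G2]). Since [thru i.+1 k] <= q^(k-n) [thru i k] and
    [npt i] is about q^(i-1), the i-th term of the sum is about
    q^((i-2)(n-k-i-1)) times smaller than q^2 [thru 2 k]. This exponent is
    concave in i, and positive at i = 3 and i = k in all the ranges considered.
    In these ranges the gain also outweighs the accumulated constants
    (q / (q - 1))^i, which yields both the bound and the improved bound with the
    factor 2/q.

    For k = 3 this estimate is too weak: when n = 7, all planes of a
    5-space have the same diversity q^3 (q^3 + q^2 + q + 1) as G2. Take A inside
    a maximal intersecting family C of subspaces of dimension at most 3. If C
    contains a line, either its lines form a triangle, and then A is inside a G2,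
    or they all pass through a point P, and branching from one of them bounds the
    members missing P ([missing_line_cover]). Otherwise C consists of planes and
    no line meets all of them. If every line is in at most q + 1 members, a
    double count at a most popular point suffices ([few_planes_on_lines]).
    If some line L is in more members, the points where these members meet a
    member E disjoint from L span E; so a single 5-space U contains all members
    through L and all members disjoint from L. Either U contains all of C, or the
    remaining members meet U in lines crossing L, which is restrictive enough
    ([missing_rich_line]).

    For k = 2 the structure of intersecting families of lines is all that is
    needed, and for k = 1 the diversity vanishes. *)

(** * Counting subspaces *)

Lemma union_bound (I T : finType) (B : {set I}) (S : {set T})
    (R : I -> pred T) (c : nat) :
    (forall x : T, x \in S -> exists2 i, i \in B & R i x) ->
    (forall i, i \in B -> #|[set x in S | R i x]| <= c) ->
  #|S| <= #|B| * c.
Proof.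
move=> cover bound.
have sub : S \subset \bigcup_(i in B) [set x in S | R i x].
  apply/subsetP=> W WS; have [i iB RiW] := cover _ WS.
  by apply/bigcupP; exists i => //; rewrite inE WS.
apply: leq_trans (subset_leq_card sub) _.
rewrite -sum_nat_const.
apply: leq_trans (_ : \sum_(i in B) #|[set x in S | R i x]| <= _).
  elim/big_ind2: _ => [|x1 x2 y1 y2 h1 h2|i _] //; first by rewrite cards0.
  by apply: leq_trans (leq_card_setU _ _) _; apply: leq_add.
exact: leq_sum.
Qed.

Section Subspaces.

Variables (F : finFieldType) (n : nat).
Local Notation V := 'rV[F]_n.
Local Notation q := #|F|.
Implicit Types A B C S : {set {vspace V}}.
Implicit Types E G H L P Q T U W X Y x y z w : {vspace V}.

Lemma q_gt1 : 1 < q.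
Proof. exact: finNzRing_gt1. Qed.

Definition points U : {set {vspace V}} := [set P in subspaces _ 1 | (P <= U)%VS].

Lemma pointsP P U : reflect (\dim P = 1 /\ (P <= U)%VS) (P \in points U).
Proof. by rewrite !inE; apply: (iffP andP) => -[/eqP]. Qed.

Lemma exists_point U : U != 0%VS -> exists2 P, \dim P = 1 & (P <= U)%VS.
Proof.
move=> U0; exists <[vpick U]>%VS; last by rewrite -memvE memv_pick.
by rewrite dim_vline vpick0 U0.
Qed.

Lemma meet_point U W : (U :&: W)%VS != 0%VS ->
  exists2 P, P \in points W & (P <= U)%VS.
Proof.
case/exists_point=> P dP; rewrite subv_cap => /andP[PU PW].
by exists P => //; apply/pointsP.
Qed.

Definition between W E k : {set {vspace V}} :=
  [set U in subspaces _ k | (W <= U)%VS && (U <= E)%VS].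

(** Double counting of the pairs (v, U) with U between W and E and v in U but not
    in W: such a U also lies above W + <[v]>. *)
Lemma card_between_rec W E k c : (W <= E)%VS ->
    (forall v, v \in E -> v \notin W -> #|between (W + <[v]>) E k| = c) ->
  \dim W <= k ->
  #|between W E k| * (q ^ k - q ^ \dim W) = (q ^ \dim E - q ^ \dim W) * c.
Proof.
move=> WE cst Wk.
have cardD U : (W <= U)%VS ->
    #|[set v | (v \in U) && (v \notin W)]| = q ^ \dim U - q ^ \dim W.
  move=> WU; rewrite -!card_vspace.
  rewrite -(cardsE [in U]) -(cardsE [in W]) -cardsDS.
    by apply: eq_card => v; rewrite !inE andbC.
  by apply/subsetP=> v; rewrite !inE; apply: (subvP WU).
transitivity (\sum_(U in between W E k) #|[set v | (v \in U) && (v \notin W)]|).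
  rewrite -sum_nat_const; apply: eq_bigr => U;
    rewrite !inE => /andP[/eqP <- /andP[WU _]].
  by rewrite cardD.
under eq_bigr => U _ do rewrite -sum1_card big_mkcond.
rewrite exchange_big /= -cardD // -sum_nat_const [RHS]big_mkcond.
apply: eq_bigr => v _; rewrite -big_mkcondr sum1dep_card /= inE.
case: ifP => [/andP[vE vW]|nv].
  rewrite -(cst _ vE vW); apply: eq_card => U.
  rewrite !inE subv_add -memvE vW andbT -!andbA.
  by do !bool_congr; rewrite andbC.
apply/eqP; rewrite cards_eq0; apply/eqP/setP => U; rewrite !inE;
  apply/negP=> /andP[/andP[_ /andP[_ UE]] /andP[vU vW]].
by rewrite (subvP UE _ vU) vW in nv.
Qed.

(** The Gaussian binomial coefficient [e - i choose k - i] in base q. It is kept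
    rational and in product form, so that no divisibility has to be proved. *)
Definition gauss e i k : rat :=
  (\prod_(i <= j < k) ((q%:R ^+ e - q%:R ^+ j) / (q%:R ^+ k - q%:R ^+ j)))%R.

Lemma gauss_rec e i k : i < k ->
  (gauss e i k * (q%:R ^+ k - q%:R ^+ i) = (q%:R ^+ e - q%:R ^+ i) * gauss e i.+1 k)%R.
Proof.
move=> ik; rewrite /gauss big_ltn //.
have : (q%:R ^+ k - q%:R ^+ i : rat)%R != 0%R.
  by rewrite subr_eq0 gt_eqF // ltr_eXn2l ?ltr1n ?q_gt1.
by move=> h; field.
Qed.

Lemma dim_addpoint W P : \dim P = 1 -> ~~ (P <= W)%VS -> \dim (W + P) = (\dim W).+1.
Proof.
move=> dP PW; rewrite dimv_disjoint_sum ?dP ?addn1 //.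
apply: contraNeq PW => h; have [Q dQ] := exists_point h.
rewrite subv_cap => /andP[QW QP].
suff /eqP-> : P == Q by [].
by rewrite eq_sym eqEdim QP dP dQ.
Qed.

Lemma card_between W E k : (W <= E)%VS -> \dim W <= k ->
  (#|between W E k|%:R = gauss (\dim E) (\dim W) k)%R.
Proof.
move=> WE; have [d] := ubnP (k - \dim W).
elim: d W WE => // d IH W WE dk; rewrite leq_eqVlt => /predU1P[Wk|Wk].
  rewrite /gauss Wk big_geq //.
  have -> : between W E k = [set W]; last by rewrite cards1.
  apply/setP=> U; rewrite !inE; apply/idP/eqP => [/andP[/eqP dU /andP[WU _]]|->].
    by apply/eqP; rewrite eq_sym eqEdim WU dU Wk /=.
  by rewrite Wk eqxx subvv.
have pos : (q%:R ^+ k - q%:R ^+ \dim W : rat)%R != 0%R.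
  by rewrite subr_eq0 gt_eqF // ltr_eXn2l ?ltr1n ?q_gt1.
have le1 : q ^ \dim W <= q ^ k by rewrite leq_exp2l ?q_gt1 // ltnW.
have le2 : q ^ \dim W <= q ^ \dim E by rewrite leq_exp2l ?q_gt1 // dimvS.
apply: (mulIf pos); rewrite gauss_rec //.
have dimv v : v \notin W -> \dim (W + <[v]>) = (\dim W).+1.
  move=> vW; apply: dim_addpoint; last by rewrite -memvE.
  by rewrite dim_vline; case: eqP vW => // ->; rewrite mem0v.
have IHv v : v \in E -> v \notin W ->
    (#|between (W + <[v]>) E k|%:R = gauss (\dim E) (\dim W).+1 k)%R.
  move=> vE vW; rewrite IH ?dimv //; first by rewrite subv_add WE -memvE.
  by lia.
have [EW|] := boolP (E <= W)%VS.
  have -> : E = W by apply/eqP; rewrite eqEsubv EW.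
  suff -> : between W W k = set0 by rewrite cards0 subrr !mul0r.
  apply/setP=> U; rewrite !inE; apply/negP => /andP[/eqP dU /andP[_ /dimvS]].
  by rewrite dU; lia.
case/subvPn=> v0 v0E v0W.
rewrite -(IHv _ v0E v0W) -!natrX -!natrB // -!natrM; congr (_%:R)%R.
apply: card_between_rec => // [v vE vW|]; last exact: ltnW.
by apply/eqP; rewrite -(eqr_nat rat) !IHv.
Qed.

(** The value (q^d - 1) / (q - 1), see [npt_mul]. *)
Definition npt d := \sum_(j < d) q ^ j.

Lemma nptS d : npt d.+1 = npt d + q ^ d.
Proof. by rewrite /npt big_ord_recr. Qed.

Lemma npt1 : npt 1 = 1.
Proof. by rewrite nptS /npt big_ord0. Qed.

Lemma npt2 : npt 2 = q + 1.
Proof. by rewrite nptS npt1 expn1 addnC. Qed.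

Lemma npt3 : npt 3 = q ^ 2 + q + 1.
Proof. by rewrite nptS npt2; ring. Qed.

Lemma leq_npt : {homo npt : d e / d <= e}.
Proof.
by move=> d e /subnK <-; elim: (e - d) => // m IH; rewrite addSn nptS; lia.
Qed.

Lemma npt_mul d : npt d * (q - 1) = q ^ d - 1.
Proof. by rewrite !subn1 predn_exp mulnC. Qed.

Lemma card_points U : #|points U| = npt (\dim U).
Proof.
have q1 := q_gt1.
apply/eqP; rewrite -(@eqn_pmul2r (q - 1)) ?subn_gt0 // npt_mul; apply/eqP.
have -> : points U = between 0%VS U 1.
  by apply/setP=> P; rewrite !inE sub0v.
have d0 : \dim (0%VS : {vspace V}) = 0%N by exact: dimv0.
have := @card_between_rec 0%VS U 1 1; rewrite d0 expn0 expn1 muln1; apply;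
  rewrite ?sub0v // => v vU v0.
have -> : between (0%VS + <[v]>) U 1 = [set <[v]>%VS]; last by rewrite cards1.
have dv : \dim <[v]> = 1 by rewrite dim_vline -memv0 v0.
apply/setP=> P; rewrite add0v !inE; apply/idP/eqP => [/andP[/eqP dP /andP[vP _]]|->].
  by apply/eqP; rewrite eq_sym eqEdim vP dP dv.
by rewrite dv eqxx subvv.
Qed.

Lemma meet_pointE P U : \dim P = 1 -> ((P :&: U)%VS != 0%VS) = (P <= U)%VS.
Proof.
move=> dP; apply/idP/idP => [h|/capv_idPl->]; last first.
  by rewrite -dimv_eq0 dP.
have [Q dQ] := exists_point h.
rewrite subv_cap => /andP[QP QU].
suff /eqP-> : P == Q by [].
by rewrite eq_sym eqEdim QP dP dQ.
Qed.

Lemma point_eq P Q : \dim P = 1 -> \dim Q = 1 -> (P <= Q)%VS -> P = Q.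
Proof. by move=> dP dQ PQ; apply/eqP; rewrite eqEdim PQ dP dQ. Qed.

Lemma dim_join_points P Q : \dim P = 1 -> \dim Q = 1 -> P != Q -> \dim (P + Q) = 2.
Proof.
move=> dP dQ PQ; rewrite dim_addpoint ?dP //.
by apply: contra PQ => /point_eq->.
Qed.

Lemma sub_dim_eq U W : (U <= W)%VS -> \dim W <= \dim U -> U = W.
Proof. by move=> UW d; apply/eqP; rewrite eqEdim UW d. Qed.

Definition deg S U := #|[set W in S | (U <= W)%VS]|.

(** The elementary branching step: if the members of S through U all meet E,
    each of them contains U + x for some point x of E. *)
Lemma branch S U E c :
    (forall W, W \in S -> (U <= W)%VS -> (W :&: E)%VS != 0%VS) ->
    (forall x, x \in points E -> deg S (U + x) <= c) ->
  deg S U <= npt (\dim E) * c.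
Proof.
move=> meets bound; rewrite -card_points.
apply: (@union_bound _ _ _ _ (fun x W => (x <= W)%VS)) => [W|x xE].
  by rewrite inE => /andP[WS UW]; apply: meet_point; apply: meets.
apply: leq_trans (bound x xE); apply: eq_leq; apply: eq_card => W.
by rewrite !inE subv_add andbA.
Qed.

(** * Saturated families and branching *)

Definition meeting A := forall U W, U \in A -> W \in A -> (U :&: W)%VS != 0%VS.

Lemma intersectingP A : intersecting A <-> meeting A.
Proof.
by split=> h U W UA WA; have := h _ _ UA WA; rewrite lt0n dimv_eq0.
Qed.

(** Maximal pairwise intersecting families among the subspaces of dimension at
    most i. Only the consequence of maximality that drives branching is recorded:
    a subspace left out is disjoint from some member. *)
Definition saturated i C :=
  [/\ forall U, U \in C -> \dim U <= i, meeting C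
    & forall U, U != 0%VS -> \dim U <= i -> U \notin C ->
        exists2 E, E \in C & (U :&: E = 0)%VS].

Lemma saturate i A : (forall U, U \in A -> \dim U <= i) -> meeting A ->
  exists2 C : {set {vspace V}}, A \subset C & saturated i C.
Proof.
move=> Ai Am.
pose pr (C : {set {vspace V}}) := [forall U in C, (\dim U <= i) &&
   [forall W in C, (U :&: W)%VS != 0%VS]].
have prA : pr A.
  apply/forall_inP=> U UA; rewrite Ai //=; apply/forall_inP=> W; exact: Am.
have [C /maxsetP[/forall_inP prC maxC] AC] := maxset_exists prA.
exists C => //; split=> [U /prC/andP[]//|U W /prC/andP[_ /forall_inP] h|];
  first exact: h.
move=> U U0 Ui UC.
case: (pickP [pred E in C | (U :&: E)%VS == 0%VS]) => [E /andP[EC /eqP h]|none].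
  by exists E.
have h E : E \in C -> (U :&: E)%VS != 0%VS.
  by move=> EC; have /= := none E; rewrite EC /= => ->.
suff CE : U |: C = C by rewrite -CE setU11 in UC.
apply: maxC; last exact: subsetUr.
apply/forall_inP=> W; rewrite in_setU1 => /predU1P[->|WC].
  rewrite Ui; apply/forall_inP=> E; rewrite in_setU1 => /predU1P[->|/h//].
  by rewrite capvv.
have /andP[-> /forall_inP hW] := prC _ WC.
apply/forall_inP=> E; rewrite in_setU1 => /predU1P[->|/hW//].
by rewrite capvC h.
Qed.

Lemma meeting_neq0 C U : meeting C -> U \in C -> U != 0%VS.
Proof. by move=> mC UC; have := mC _ _ UC UC; rewrite capvv. Qed.

Lemma meetingS A B : A \subset B -> meeting B -> meeting A.
Proof. by move=> /subsetP AB h U W /AB UB /AB; apply: h. Qed.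

Definition minimal_of i C := [set W in C | (\dim W == i) &&
  [forall U in C, (U <= W)%VS ==> (U == W)]].

(** A subspace U strictly below a minimal member is not in C, so some member of C
    is disjoint from it, and every member of C above U contains one of at most
    [npt i] one-point extensions of U. Starting from U = 0, i such steps reach
    dimension i. *)
Lemma card_minimal i C : saturated i C -> #|minimal_of i C| <= npt i ^ i.
Proof.
move=> [dC mC sat]; set M := minimal_of i C.
have MC W : W \in M -> W \in C by rewrite inE => /andP[].
suff main j U : j <= i -> \dim U = i - j -> deg M U <= npt i ^ j.
  have := main i 0%VS (leqnn _); rewrite subnn dimv0 => /(_ erefl).
  apply: leq_trans; apply: subset_leq_card; apply/subsetP=> W WM.
  by rewrite inE WM sub0v.
elim: j U => [|j IH] U ji dU.
  rewrite expn0 -(cards1 U); apply: subset_leq_card; apply/subsetP=> W.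
  rewrite !inE => /andP[/andP[_ /andP[/eqP dW _]] UW].
  by rewrite eq_sym eqEdim UW dW dU subn0 /=.
have [UC|UC] := boolP (U \in C).
  (* no minimal member lies strictly above a member of C *)
  have -> : deg M U = 0; last by [].
  apply/eqP; rewrite cards_eq0; apply/eqP/setP=> W; rewrite !inE; apply/negP.
  move=> /andP[/andP[WC /andP[/eqP dW /forall_inP minW]] UW].
  by have := minW _ UC; rewrite UW => /eqP UW'; rewrite UW' in dU; lia.
have [M0|[W0 W0M]] := set_0Vmem M.
  by rewrite /deg M0; apply: leq_trans (leq0n _); rewrite leqn0 cards_eq0;
    apply/eqP/setP=> W; rewrite !inE.
have [E EC UE] : exists2 E, E \in C & (U :&: E = 0)%VS.
  have [->|U0] := eqVneq U 0%VS; first by exists W0; [exact: MC | rewrite cap0v].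
  by apply: sat => //; rewrite dU leq_subr.
have dE : npt (\dim E) <= npt i by apply/leq_npt/dC.
rewrite expnS; apply: leq_trans (_ : npt (\dim E) * npt i ^ j <= _);
  last by rewrite leq_mul2r dE orbT.
apply: branch => [W /MC WC _|x /pointsP[dx xE]]; first exact: mC.
apply: IH; first exact: ltnW.
rewrite dim_addpoint ?dU //; first by lia.
apply/negP=> xU; have : (x <= U :&: E)%VS by rewrite subv_cap xU.
by rewrite UE subv0 -dimv_eq0 dx.
Qed.

Lemma subspaces_between U k :
  [set W in subspaces V k | (U <= W)%VS] = between U fullv k.
Proof. by apply/setP=> W; rewrite !inE subvf andbT. Qed.

(** The number of k-spaces through an i-space, as a natural number: truncation
    loses nothing when i-spaces exist, by [deg_subspacesE]. The case split is
    needed because the product [gauss] is empty, hence 1, for k < i. *)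
Definition thru i k : nat := if i <= k then Num.truncn (gauss n i k) else 0.

Lemma deg_subspacesE U k : \dim U <= k ->
  ((deg (subspaces V k) U)%:R = gauss n (\dim U) k)%R.
Proof.
move=> Uk; rewrite /deg subspaces_between card_between ?subvf // dimvf.
by rewrite /dim /= mul1n.
Qed.

Lemma deg_subspaces U k : deg (subspaces V k) U = thru (\dim U) k.
Proof.
rewrite /thru; case: leqP => [Uk|Uk]; first by rewrite -deg_subspacesE // natrK.
apply/eqP; rewrite cards_eq0; apply/eqP/setP=> W; rewrite !inE; apply/negP.
by move=> /andP[/eqP dW /dimvS]; rewrite dW leqNgt Uk.
Qed.

Lemma leq_deg A B U : A \subset B -> deg A U <= deg B U.
Proof.
move=> /subsetP AB; apply: subset_leq_card; apply/subsetP=> W.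
by rewrite !inE => /andP[/AB-> ->].
Qed.

Lemma deg_thru A U k : A \subset subspaces V k -> deg A U <= thru (\dim U) k.
Proof. by move=> Ak; rewrite -deg_subspaces leq_deg. Qed.

Definition uncovered A C := [set U in A | ~~ [exists W in C, (W <= U)%VS]].

(** Going from C_(j+1) to C_j, a member of A is lost only if it contains a minimal
    member of C_(j+1) of dimension j + 1. *)
Lemma peeling k A j : A \subset subspaces V k -> meeting A -> j <= k ->
  exists2 C : {set {vspace V}}, saturated j C &
    #|uncovered A C| <= \sum_(j.+1 <= i < k.+1) npt i ^ i * thru i k.
Proof.
move=> Ak mA; elim: {j}(k - j) {-2}j (erefl (k - j)) => [|d IH] j dj jk.
  have -> : j = k by lia.
  have [|C AC satC] := @saturate k A _ mA.
    by move=> U /(subsetP Ak); rewrite inE => /eqP->.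
  exists C => //; rewrite big_geq //.
  have -> : uncovered A C = set0; last by rewrite cards0.
  apply/setP=> U; rewrite !inE; apply/negP=> /andP[UA /negP[]].
  by apply/exists_inP; exists U; rewrite ?subvv // (subsetP AC).
have [||C satC unc] := IH j.+1; [lia | lia | have [dC mC sat] := satC].
pose D := [set W in C | \dim W <= j].
have [||C' /subsetP DC' satC'] := @saturate j D.
- by move=> U; rewrite inE => /andP[].
- by apply: meetingS mC; apply/subsetP=> W; rewrite inE => /andP[].
exists C' => //; rewrite big_ltn 1?addnC; last by lia.
(* the members of A that this step of the peeling may lose *)
pose N := [set U in A | [exists W in minimal_of j.+1 C, (W <= U)%VS]].
apply: leq_trans (_ : #|uncovered A C :|: N| <= _).
  apply: subset_leq_card; apply/subsetP=> U; rewrite inE => /andP[UA nC'].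
  rewrite inE orbC !inE UA /=; case: exists_inP => //= nM;
    apply/exists_inP=> -[W WC WU].
  have dW : j < \dim W.
    rewrite ltnNge; apply: contra nC' => dW; apply/exists_inP; exists W => //.
    by apply: DC'; rewrite inE WC.
  case: nM; exists W => //; rewrite inE WC eqn_leq dC //= dW /=.
  apply/forall_inP=> E EC; apply/implyP=> EW; rewrite eqEdim EW.
  rewrite (leq_trans (dC _ WC)) // ltnNge; apply: contra nC' => dE.
  apply/exists_inP; exists E; last exact: subv_trans WU.
  by apply: DC'; rewrite inE EC.
apply: leq_trans (leq_card_setU _ _) (leq_add unc _).
apply: leq_trans (_ : #|minimal_of j.+1 C| * thru j.+1 k <= _); last first.
  by rewrite leq_mul2r card_minimal ?orbT.
apply: (@union_bound _ _ _ _ (fun W U => (W <= U)%VS)) => [U|W].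
  by rewrite inE => /andP[_ /exists_inP].
rewrite inE => /and3P[_ /eqP dW _].
rewrite -dW; apply: (@deg_thru N).
by apply: subset_trans Ak; apply/subsetP=> U; rewrite inE => /andP[].
Qed.

(** * Intersecting families of lines *)

Lemma meet_lines T T' : \dim T = 2 -> \dim T' = 2 -> T != T' -> (T :&: T')%VS != 0%VS ->
  \dim (T :&: T') = 1 /\ \dim (T + T') = 3.
Proof.
move=> dT dT' TT'; rewrite -dimv_eq0 => m0; have := dimv_sum_cap T T'; rewrite dT dT'.
suff : \dim (T :&: T') < 2 by lia.
rewrite ltnNge; apply: contra TT' => d2.
have /eqP <- : (T :&: T')%VS == T by rewrite eqEdim capvSl dT.
by rewrite eqEdim capvSr dT'.
Qed.

Lemma line_span T P Q : \dim T = 2 -> \dim P = 1 -> \dim Q = 1 -> P != Q ->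
  (P <= T)%VS -> (Q <= T)%VS -> T = (P + Q)%VS.
Proof.
by move=> dT dP dQ PQ PT QT; apply/esym/sub_dim_eq;
  rewrite ?subv_add ?PT ?dim_join_points ?dT.
Qed.

(** Two distinct lines T1, T2 meet in a point P and span a 3-space Y. A line off P
    meets T1 and T2 in different points, so it lies in Y; a line through P lies in
    Y because it also meets some line T3 off P. A member of dimension 1 is itself
    a common point. *)
Lemma lines_concurrent_or_coplanar C : (exists P, \dim P = 1 :> nat) ->
    (forall T, T \in C -> \dim T <= 2) -> meeting C ->
  (exists2 P, \dim P = 1 & forall T, T \in C -> (P <= T)%VS) \/
  (exists Y, [/\ \dim Y = 3, forall T, T \in C -> \dim T = 2 /\ (T <= Y)%VS
     & forall P, \dim P = 1 -> exists2 T, T \in C & ~~ (P <= T)%VS]).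
Proof.
move=> [P0 dP0] C2 mC.
have [/existsP[P /andP[/eqP dP /forall_inP PC]]|nconc] :=
  boolP [exists P : {vspace V}, (\dim P == 1) && [forall T in C, (P <= T)%VS]].
  by left; exists P.
right; have avoid P : \dim P = 1 -> exists2 T, T \in C & ~~ (P <= T)%VS.
  move=> dP; apply/exists_inP; rewrite -negb_forall_in; apply: contra nconc => h.
  by apply/existsP; exists P; rewrite dP.
have d2 T : T \in C -> \dim T = 2.
  move=> TC; apply/eqP; rewrite eqn_leq C2 //= ltnNge; apply/negP=> d1.
  have dT : \dim T = 1 by apply/eqP; rewrite eqn_leq d1 lt0n dimv_eq0 (meeting_neq0 mC).
  have [T' T'C /negP[]] := avoid _ dT.
  by rewrite -meet_pointE // mC.
have [T1 T1C _] := avoid _ dP0.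
have [P1 dP1 P1T1] := exists_point (meeting_neq0 mC T1C).
have [T2 T2C P1T2] := avoid _ dP1.
have T12 : T1 != T2 by apply: contraNneq P1T2 => <-.
have [dP dY] := meet_lines (d2 _ T1C) (d2 _ T2C) T12 (mC _ _ T1C T2C).
set P := (T1 :&: T2)%VS in dP; set Y := (T1 + T2)%VS in dY.
have PT1 : (P <= T1)%VS by exact: capvSl.
have PT2 : (P <= T2)%VS by exact: capvSr.
have off T : T \in C -> ~~ (P <= T)%VS -> (T <= Y)%VS.
  move=> TC PT.
  have [Q1 /pointsP[dQ1 Q1T] Q1T1] := meet_point (mC _ _ T1C TC).
  have [Q2 /pointsP[dQ2 Q2T] Q2T2] := meet_point (mC _ _ T2C TC).
  have Q12 : Q1 != Q2.
    apply: contraNneq PT => Q12; have <- // : Q1 = P.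
    by apply: point_eq => //; rewrite subv_cap Q1T1 Q12.
  rewrite (line_span (d2 _ TC) dQ1 dQ2) // subv_add.
  by rewrite (subv_trans Q1T1 (addvSl _ _)) (subv_trans Q2T2 (addvSr _ _)).
exists Y; split=> // T TC; split; first exact: d2.
have [PT|/off->//] := boolP (P <= T)%VS.
have [T3 T3C PT3] := avoid _ dP; have T3Y := off _ T3C PT3.
have [Q /pointsP[dQ QT3] QT] := meet_point (mC _ _ TC T3C).
have PQ : P != Q by apply: contraNneq PT3 => ->.
rewrite (line_span (d2 _ TC) dP dQ) // subv_add (subv_trans QT3) //.
by rewrite (subv_trans PT1 (addvSl _ _)).
Qed.

(** * Diversity as a minimum over points *)

Definition missing A P := #|[set U in A | ~~ (P <= U)%VS]|.

Lemma missing_deg A P : missing A P + deg A P = #|A|.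
Proof.
rewrite addnC -(cardsID [set U : {vspace V} | (P <= U)%VS] A).
by congr (_ + _); apply: eq_card => U; rewrite !inE // andbC.
Qed.

Lemma diversity_le A P : \dim P = 1 -> diversity A <= missing A P.
Proof.
move=> dP; rewrite leq_subLR addnC -(missing_deg A P) leq_add2l.
apply: (@leq_bigmax_cond _ [in subspaces V 1] (deg A) P).
by rewrite /= inE dP.
Qed.

(** With [diversity_le], this says that the diversity is the least number of
    members missing a point. *)
Lemma diversity_ge A t : (exists P, \dim P = 1 :> nat) ->
  (forall P, \dim P = 1 -> t <= missing A P) -> t <= diversity A.
Proof.
move=> [P0 dP0] h; have tA : t <= #|A|.
  by rewrite -(missing_deg A P0) (leq_trans (h _ dP0)) ?leq_addr.
rewrite leq_subRL; last by apply/bigmax_leqP=> P _; rewrite -(missing_deg A P) leq_addl.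
rewrite addnC -leq_subRL //; apply/bigmax_leqP=> P; rewrite inE => /eqP /h.
by rewrite -(missing_deg A P) /deg; lia.
Qed.

Lemma leq_missing A B P : A \subset B -> missing A P <= missing B P.
Proof.
move=> /subsetP AB; apply: subset_leq_card; apply/subsetP=> W.
by rewrite !inE => /andP[/AB-> ->].
Qed.

Lemma diversityS A B : (exists P, \dim P = 1 :> nat) -> A \subset B ->
  diversity A <= diversity B.
Proof.
move=> pt AB; apply: diversity_ge => // P dP.
exact: leq_trans (diversity_le A dP) (leq_missing _ AB).
Qed.

(** * The diversity of the triangle family *)

Lemma exists_dim i : i <= n -> exists U, \dim U = i.
Proof.
elim: i => [|i IH] ile; first by exists 0%VS; rewrite dimv0.
have [U dU] := IH (ltnW ile).
have /subvPn[v _ vU] : ~~ (fullv <= U)%VS.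
  by apply/negP=> /dimvS; rewrite dimvf /dim /= mul1n dU leqNgt ile.
exists (U + <[v]>)%VS; rewrite dim_addpoint ?dU -?memvE // dim_vline.
by case: eqP vU => // ->; rewrite mem0v.
Qed.

Lemma thru_rec i k : i < k -> k <= n ->
  thru i k * (q ^ k - q ^ i) = (q ^ n - q ^ i) * thru i.+1 k.
Proof.
move=> ik kn; have q1 := q_gt1; have in_ := leq_trans (ltnW ik) kn.
have [U dU] := exists_dim in_; have [U' dU'] := exists_dim (leq_trans ik kn).
have g := @deg_subspacesE U k; have g' := @deg_subspacesE U' k.
rewrite !deg_subspaces dU dU' ik (ltnW ik) in g g'.
apply/eqP; rewrite -(eqr_nat rat) !natrM !natrB ?leq_exp2l ?(ltnW ik) // !natrX.
by rewrite g // g' // gauss_rec.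
Qed.

Lemma thru_id k : thru k k = 1.
Proof. by rewrite /thru leqnn /gauss big_geq // truncn1. Qed.

Lemma thru0 i k : k < i -> thru i k = 0.
Proof. by move=> ki; rewrite /thru leqNgt ki. Qed.

(** In the quotient of [thru_rec], the factor (q^n - q^i) / (q^k - q^i) is at
    least q^(n-k). *)
Lemma thru_ratio i k : i <= k -> k <= n -> q ^ (n - k) * thru i.+1 k <= thru i k.
Proof.
have q1 := q_gt1; rewrite leq_eqVlt => /predU1P[->|ik] kn;
  first by rewrite thru0 ?muln0.
have lt : q ^ i < q ^ k by rewrite ltn_exp2l.
rewrite -(@leq_pmul2r (q ^ k - q ^ i)) ?subn_gt0 // thru_rec // mulnAC leq_mul2r.
by rewrite mulnBr -expnD subnK // leq_sub2l ?orbT // leq_pmull ?expn_gt0 ?(ltnW q1).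
Qed.

Lemma thru_ratioX i j k : i + j <= k.+1 -> k <= n ->
  q ^ ((n - k) * j) * thru (i + j) k <= thru i k.
Proof.
move=> ijk kn; elim: j ijk => [|j IH] ijk; first by rewrite muln0 expn0 mul1n addn0.
apply: leq_trans (IH _); last by lia.
rewrite mulnS addnC expnD -mulnA addnS leq_mul2l addnC thru_ratio ?orbT //; lia.
Qed.

Lemma card_lines Y : \dim Y = 3 -> #|between 0%VS Y 2| = q ^ 2 + q + 1.
Proof.
move=> dY; have q1r : (1 < q%:R :> rat)%R by rewrite ltr1n q_gt1.
have d0 : \dim (0%VS : {vspace V}) = 0 by exact: dimv0.
apply/eqP; rewrite -(eqr_nat rat) card_between ?sub0v ?d0 // dY /gauss.
rewrite big_ltn // big_ltn // big_geq // !natrD natrX; apply/eqP; field.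
by apply/andP; split; rewrite subr_eq0 ?gt_eqF //; nra.
Qed.

Lemma card_lines_through P Y : \dim P = 1 -> \dim Y = 3 -> (P <= Y)%VS ->
  #|[set L in subspaces V 2 | (L <= Y)%VS && ~~ (P <= L)%VS]| = q ^ 2.
Proof.
move=> dP dY PY; have q1 := q_gt1.
have q1r : (1 < q%:R :> rat)%R by rewrite ltr1n.
set S := [set L in _ | _].
have e1 := card_lines dY.
have e2 : #|between P Y 2| = q + 1.
  apply/eqP; rewrite -(eqr_nat rat) card_between ?dP // dY /gauss.
  rewrite big_ltn // big_geq // !natrD; apply/eqP; field.
  by rewrite subr_eq0 ?gt_eqF //; nra.
have := cardsID [set L : {vspace V} | (P <= L)%VS] (between 0%VS Y 2).
have -> : between 0%VS Y 2 :&: [set L | (P <= L)%VS] = between P Y 2.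
  by apply/setP=> L; rewrite !inE sub0v /= -andbA; do !bool_congr; rewrite andbC.
have -> : between 0%VS Y 2 :\: [set L | (P <= L)%VS] = S.
  by apply/setP=> L; rewrite !inE sub0v /= andbC -andbA.
by rewrite e1 e2 => h; apply: (@addnI (q + 1)); rewrite h -addnA addnC.
Qed.

(** A k-space through the line L of Y has trace L on Y unless it contains Y. *)
Lemma card_trace L Y k : \dim L = 2 -> \dim Y = 3 -> (L <= Y)%VS ->
  #|[set W in subspaces V k | (W :&: Y)%VS == L]| = thru 2 k - thru 3 k.
Proof.
move=> dL dY LY.
have <- : deg (subspaces V k) L = thru 2 k by rewrite deg_subspaces dL.
have <- : deg (subspaces V k) Y = thru 3 k by rewrite deg_subspaces dY.
have <- : #|[set W in subspaces V k | (L <= W)%VS]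
            :&: [set W in subspaces V k | (Y <= W)%VS]| = deg (subspaces V k) Y.
  apply: eq_card => W; rewrite !inE; apply/idP/idP => [/andP[]//|/andP[-> YW]].
  by rewrite YW (subv_trans LY YW).
rewrite -cardsD; apply: eq_card => W; rewrite !inE.
case: eqP => //= dW; apply/eqP/andP => [trW|[YW LW]].
  rewrite -trW capvSl; split=> //; apply/negP => YW.
  by have := dL; rewrite -trW (capv_idPr YW) dY.
apply/esym/sub_dim_eq; first by rewrite subv_cap LW.
rewrite dL -ltnS -dY ltn_neqAle dimvS ?capvSr // andbT.
apply: contra YW => /eqP dWY; rewrite -(sub_dim_eq (capvSr W Y)) ?dWY //.
exact: capvSl.
Qed.

Lemma card_fibers (T I : finType) (D : {set T}) (B : {set I}) (f : T -> I) :
  #|[set x in D | f x \in B]| = \sum_(i in B) #|[set x in D | f x == i]|.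
Proof.
rewrite -sum1dep_card (partition_big f (mem B)) => [|x /andP[]//] /=.
apply: eq_bigr => i iB; rewrite -sum1dep_card; apply: eq_bigl => x.
by case: eqP => [->|]; rewrite ?andbF // iB !andbT.
Qed.

Lemma missing_G2 P Y k : \dim P = 1 -> \dim Y = 3 -> (P <= Y)%VS ->
  missing (G2 k Y) P = q ^ 2 * (thru 2 k - thru 3 k).
Proof.
move=> dP dY PY; rewrite -(card_lines_through dP dY PY) -sum_nat_const.
under eq_bigr => L do [rewrite inE => /andP[/[!inE]/eqP dL /andP[LY _]];
  rewrite -(card_trace k dL dY LY)].
rewrite -card_fibers; apply: eq_card => W; rewrite !inE -andbA; congr (_ && _).
rewrite capvSr subv_cap PY andbT /=; case PW : (P <= W)%VS; rewrite ?andbF // !andbT.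
rewrite eqn_leq andbC; case: ltnP => //= d2; apply/esym.
rewrite -ltnS -dY ltn_neqAle dimvS ?capvSr // andbT.
apply/negP=> /eqP dWY; move/negP: PW; apply; apply: subv_trans PY _.
by rewrite -(sub_dim_eq (capvSr W Y)) ?dWY // capvSl.
Qed.

(** A point P of Y is settled by [missing_G2]. For P outside Y all q^2 + q + 1 lines
    L of Y contribute, and among the k-spaces with trace L those through P are few,
    as they contain the 3-space L + P. *)
Lemma diversity_G2_ge Y k : \dim Y = 3 -> 2 <= k -> k + 2 <= n ->
  q ^ 2 * (thru 2 k - thru 3 k) <= diversity (G2 k Y).
Proof.
move=> dY k2 kn; have q1 := q_gt1; apply: diversity_ge; first by apply: exists_dim; lia.
move=> P dP; have [PY|PY] := boolP (P <= Y)%VS;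
  first by rewrite (missing_G2 k dP dY PY).
have lin L : L \in between 0%VS Y 2 ->
    thru 2 k - 2 * thru 3 k <=
      #|[set W in [set W in G2 k Y | ~~ (P <= W)%VS] | (W :&: Y)%VS == L]|.
  rewrite !inE sub0v => /andP[/eqP dL /= LY].
  have LP : ~~ (P <= L)%VS by apply: contra PY => /subv_trans; apply.
  have <- : thru 2 k - thru 3 k - thru 3 k = thru 2 k - 2 * thru 3 k by lia.
  rewrite -(card_trace k dL dY LY); have dLP := dim_addpoint dP LP.
  have <- : deg (subspaces V k) (L + P) = thru 3 k by rewrite deg_subspaces dLP dL.
  rewrite leq_subLR -cardsUI; apply: leq_trans (leq_addr _ _).
  apply: subset_leq_card; apply/subsetP=> W; rewrite !inE => /andP[/eqP-> /eqP trW].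
  rewrite trW dL eqxx /= subv_add -trW capvSl /=.
  by case: (P <= W)%VS; rewrite ?eqxx.
(* the q + 1 additional lines outweigh the loss of thru 3 k on each line, since
   q^2 thru 3 k <= thru 2 k *)
apply: leq_trans (_ : npt 3 * (thru 2 k - 2 * thru 3 k) <= _).
  have : q ^ (n - k) * thru 3 k <= thru 2 k by apply: thru_ratio; lia.
  have : q ^ 2 * thru 3 k <= q ^ (n - k) * thru 3 k.
    by rewrite leq_mul2r leq_exp2l //; apply/orP; right; lia.
  rewrite npt3; nia.
rewrite npt3 -(card_lines dY) -sum_nat_const.
apply: leq_trans (@leq_sum _ (index_enum _) [in between 0%VS Y 2] _ _ lin) _.
by rewrite -card_fibers; apply: subset_leq_card; apply/subsetP=> W;
  rewrite inE => /andP[].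
Qed.

Lemma diversity_G2_le Y k : \dim Y = 3 ->
  diversity (G2 k Y) <= q ^ 2 * (thru 2 k - thru 3 k).
Proof.
move=> dY; have [|P dP PY] := @exists_point Y; first by rewrite -dimv_eq0 dY.
by rewrite -(missing_G2 k dP dY PY) diversity_le.
Qed.

(** The peeling loss bounds the members that contain no line of C_2. When these
    lines are coplanar in Y and U0 in A meets Y at most in the point P, a member
    with trace L on Y, for a line L off P, must meet U0 outside L. *)
Lemma diversity_not_in_G2 k A : A \subset subspaces V k -> meeting A -> 2 <= k <= n ->
    (forall Y, \dim Y = 3 -> ~ A \subset G2 k Y) ->
  diversity A <= \sum_(3 <= i < k.+1) npt i ^ i * thru i k + q ^ 2 * npt k * thru 3 k.
Proof.
move=> Ak mA /andP[k2 kn] notG2.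
have [C [dC mC _] unc] := peeling Ak mA k2.
have pt : exists P, \dim P = 1 by apply: exists_dim; lia.
have [[P dP PC]|[Y [dY CY _]]] := lines_concurrent_or_coplanar pt dC mC.
  (* a member containing an element of C contains P *)
  apply: leq_trans (diversity_le A dP) _; apply: leq_trans (leq_addr _ _).
  apply: leq_trans unc; apply: subset_leq_card; apply/subsetP=> U.
  rewrite !inE => /andP[-> PU] /=; apply: contra PU => /exists_inP[T TC TU].
  by apply: subv_trans TU; apply: PC.
have /subsetPn[U0 U0A] : ~~ (A \subset G2 k Y) by apply/negP/notG2.
rewrite inE (subsetP Ak) //= -ltnNge ltnS => trU0.
have [P dP /andP[PY trP]] : exists2 P, \dim P = 1 & (P <= Y)%VS && (U0 :&: Y <= P)%VS.
  have [tr0|/exists_point[P dP]] := eqVneq (U0 :&: Y)%VS 0%VS.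
    have [|P dP PY] := @exists_point Y; first by rewrite -dimv_eq0 dY.
    by exists P; rewrite // PY tr0 sub0v.
  move=> PU; exists P => //; rewrite (subv_trans PU (capvSr _ _)) /=.
  by rewrite -(sub_dim_eq PU) ?dP.
apply: leq_trans (diversity_le A dP) _.
(* a member missing P cannot contain Y, so its trace on Y is exactly a line *)
pose B := [set U in A | (\dim (U :&: Y) == 2) && ~~ (P <= U)%VS].
apply: leq_trans (_ : #|uncovered A C :|: B| <= _).
  apply: subset_leq_card; apply/subsetP=> U; rewrite !inE => /andP[-> PU] /=.
  case: exists_inP => //= -[T TC TU]; rewrite PU andbT.
  have [dT TY] := CY _ TC.
  have TUY : (T <= U :&: Y)%VS by rewrite subv_cap TU.
  rewrite eqn_leq andbC -{1}dT dimvS //= -ltnS -dY ltn_neqAle dimvS ?capvSr // andbT.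
  apply: contra PU => /eqP dUY; apply: subv_trans PY _.
  by rewrite -(sub_dim_eq (capvSr U Y)) ?dUY // capvSl.
apply: leq_trans (leq_card_setU _ _) (leq_add unc _).
rewrite -(card_lines_through dP dY PY) -mulnA.
apply: (@union_bound _ _ _ _ (fun L U => (L <= U)%VS)) => [U|L].
  rewrite inE => /and3P[UA dUY PU]; exists (U :&: Y)%VS; last exact: capvSl.
  by rewrite !inE dUY capvSr subv_cap PY andbT.
rewrite inE => /andP[/[!inE] /eqP dL /andP[LY PL]].
have dU0 : \dim U0 = k by have /[!inE]/eqP := subsetP Ak _ U0A.
have BA : B \subset A by apply/subsetP=> U; rewrite inE => /andP[].
rewrite -{1}dU0; apply: branch => [U UB _|x /pointsP[dx xU0]].
  by apply: mA => //; apply: (subsetP BA).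
have xL : ~~ (x <= L)%VS.
  apply/negP=> xL; have xP : (x <= P)%VS.
    by apply: subv_trans trP; rewrite subv_cap xU0 (subv_trans xL).
  by move/negP: PL; apply; rewrite -(point_eq dx dP xP).
apply: leq_trans (deg_thru _ (subset_trans BA Ak)) _.
by rewrite dim_addpoint // dL.
Qed.

(** * Points, lines and planes *)

Lemma sub_point_cap0 P U W : \dim P = 1 -> (U :&: W = 0)%VS -> (P <= U)%VS ->
  (P <= W)%VS -> False.
Proof.
move=> dP UW PU PW; have : (P <= U :&: W)%VS by rewrite subv_cap PU.
by rewrite UW subv0 -dimv_eq0 dP.
Qed.

Lemma sub_of_dim_cap U W : \dim U <= \dim (U :&: W) -> (U <= W)%VS.
Proof. by move=> d; apply/capv_idPl/sub_dim_eq; rewrite ?capvSl. Qed.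

(** A subspace meeting Y only in a point would need that point on all the lines. *)
Lemma meets_triangle C U Y : meeting C -> C != set0 ->
    (forall T, T \in C -> \dim T = 2 /\ (T <= Y)%VS) ->
    (forall P, \dim P = 1 -> exists2 T, T \in C & ~~ (P <= T)%VS) ->
    (forall T, T \in C -> (U :&: T)%VS != 0%VS) ->
  2 <= \dim (U :&: Y).
Proof.
move=> mC /set0Pn[T0 T0C] CY avoid meets; rewrite ltnNge; apply/negP => d1.
have dP : \dim (U :&: Y) = 1.
  apply/eqP; rewrite eqn_leq d1 lt0n dimv_eq0; apply: contraNneq (meets _ T0C) => UY0.
  by rewrite -subv0 -UY0 capvS // (CY _ T0C).2.
have [T TC /negP[]] := avoid _ dP.
have [x /pointsP[dx xT] xU] := meet_point (meets _ TC).
by rewrite -(point_eq dx dP) // subv_cap xU (subv_trans xT) // (CY _ TC).2.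
Qed.

Lemma cards_points_but P U : P \in points U -> #|points U :\ P| = npt (\dim U) - 1.
Proof. by move=> PU; rewrite -card_points [in RHS](cardsD1 P) PU addKn. Qed.

Lemma deg_plane C U : C \subset subspaces V 3 -> \dim U = 3 -> deg C U <= 1.
Proof. by move=> C3 dU; have := deg_thru U C3; rewrite dU thru_id. Qed.

Lemma deg_line C L E : C \subset subspaces V 3 -> \dim L = 2 -> \dim E <= 3 ->
    (forall W, W \in C -> (W :&: E)%VS != 0%VS) -> (L :&: E = 0)%VS ->
  deg C L <= npt 3.
Proof.
move=> C3 dL dE meets LE.
apply: leq_trans (leq_npt dE); rewrite -[leqRHS]muln1.
apply: branch => [W /meets //|x /pointsP[dx xE]].
by apply: deg_plane; rewrite // dim_addpoint // ?dL //;
  apply/negP => /sub_point_cap0; apply; eauto.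
Qed.

(** * Families of planes with a line among the generators *)

Section LineCover.

Variables (C A : {set {vspace V}}) (P T : {vspace V}).
Hypotheses (satC : saturated 3 C) (AC : A \subset C) (A3 : A \subset subspaces V 3).
Hypotheses (dP : \dim P = 1) (TC : T \in C) (dT : \dim T = 2).
Hypotheses (noPt : forall Q, \dim Q = 1 -> Q \notin C).
Hypothesis throughP : forall L, L \in C -> \dim L = 2 -> (P <= L)%VS.

(** A member missing P meets T in one of q points Q. For a member E of C disjoint
    from Q, it contains a line joining Q to a point R of E; the point R0 of E on T
    is excluded, since Q + R0 = T contains P. The line Q + R is also off P, so it is
    not in C, and at most [npt 3] members contain it. *)
Lemma missing_line_cover : missing A P <= q * ((q ^ 2 + q) * npt 3).
Proof.
have [dC mC sat] := satC.
have PT : P \in points T by apply/pointsP; split=> //; apply: throughP.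
have -> : q = #|points T :\ P| by rewrite cards_points_but // dT npt2 addnK.
rewrite [in X in _ <= _ * X]cards_points_but // dT npt2 addnK.
pose B := [set U in A | ~~ (P <= U)%VS].
have BA : B \subset A by apply/subsetP=> U; rewrite inE => /andP[].
have BC U : U \in B -> U \in C by move/(subsetP BA)/(subsetP AC).
have B3 : B \subset subspaces V 3 := subset_trans BA A3.
apply: (@union_bound _ _ _ _ (fun Q U => (Q <= U)%VS)) => [U UB|Q].
  have [Q QT QU] := meet_point (mC _ _ (BC _ UB) TC).
  exists Q => //; rewrite in_setD1 QT andbT; apply: contraTneq UB => <-.
  by rewrite inE QU andbF.
rewrite in_setD1 => /andP[QP /pointsP[dQ QT]].
have [E EC QE] : exists2 E, E \in C & (Q :&: E = 0)%VS.
  by apply: sat; rewrite ?noPt ?dQ // -dimv_eq0 dQ.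
have [R0 R0E R0T] := meet_point (mC _ _ TC EC); have /pointsP[dR0 R0E'] := R0E.
have cE : #|points E :\ R0| <= q ^ 2 + q.
  by rewrite cards_points_but // leq_subLR addnC -npt3 leq_npt ?dC.
apply: leq_trans (_ : #|points E :\ R0| * npt 3 <= _);
  last by rewrite leq_mul2r cE orbT.
apply: (@union_bound _ _ _ _ (fun R U => (R <= U)%VS)) => [U|R].
  rewrite inE => /andP[UB QU]; have [R RE RU] := meet_point (mC _ _ (BC _ UB) EC).
  exists R => //; rewrite in_setD1 RE andbT; apply: contraTneq UB => RR0.
  have TE : T = (Q + R0)%VS.
    apply: line_span => //; apply: contraTneq R0E' => <-.
    by apply/negP; apply: (sub_point_cap0 dQ QE).
  rewrite inE negb_and negbK; apply/orP; right; case/pointsP: PT => _ /subv_trans;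
    apply.
  by rewrite TE subv_add QU -RR0.
rewrite in_setD1 => /andP[_ /pointsP[dR RE]].
have QR : Q != R.
  by apply: contraTneq RE => <-; apply/negP => /(sub_point_cap0 dQ QE (subvv _)).
have dL := dim_join_points dQ dR QR; set L := (Q + R)%VS in dL.
have -> : [set U in [set U in B | (Q <= U)%VS] | (R <= U)%VS]
    = [set U in B | (L <= U)%VS].
  by apply/setP=> U; rewrite !inE subv_add !andbA.
have [PL|PL] := boolP (P <= L)%VS.
  rewrite (_ : [set _ in _ | _] = set0) ?cards0 //; apply/setP=> U; rewrite !inE;
    apply/negP.
  by move=> /andP[/andP[_ /negP PU] LU]; apply: PU; apply: subv_trans LU.
have [E' E'C LE'] : exists2 E, E \in C & (L :&: E = 0)%VS.
  apply: sat; rewrite ?dL // -?dimv_eq0 ?dL //.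
  by apply: contra PL => /throughP; apply.
by apply: (deg_line B3 dL (dC _ E'C)) => // W /BC WC; apply: mC.
Qed.

End LineCover.

(** This bound is the extremal one: it is attained by all planes of a 5-space. *)
Lemma missing_in_5space C P U : \dim P = 1 -> \dim U = 5 -> (P <= U)%VS ->
    C \subset subspaces V 3 -> (forall W, W \in C -> (W <= U)%VS) ->
  missing C P <= q ^ 3 * (q ^ 3 + q ^ 2 + q + 1).
Proof.
move=> dP dU PU C3 CU.
have q1 : (1 < q%:R :> rat)%R by rewrite ltr1n q_gt1.
pose B := [set W in between 0%VS U 3 | ~~ (P <= W)%VS].
apply: leq_trans (_ : #|B| <= _).
  apply: subset_leq_card; apply/subsetP=> W; rewrite !inE => /andP[WC ->].
  by rewrite sub0v CU // !andbT; have := subsetP C3 _ WC; rewrite inE.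
have cB : #|between P U 3| + #|B| = #|between 0%VS U 3|.
  rewrite -(cardsID [set W : {vspace V} | (P <= W)%VS] (between 0%VS U 3)).
  congr (_ + _); apply: eq_card => W; rewrite !inE; last by rewrite andbC.
  by rewrite sub0v /= -andbA; do !bool_congr; rewrite andbC.
have d0 : \dim (0%VS : {vspace V}) = 0 by exact: dimv0.
have nz2 : (q%:R ^+ 3 - q%:R ^+ 2 : rat)%R != 0%R.
  by rewrite subr_eq0 gt_eqF // ltr_eXn2l.
have nz1 : (q%:R ^+ 3 - q%:R : rat)%R != 0%R.
  by rewrite subr_eq0 gt_eqF // -[ltLHS]expr1 ltr_eXn2l.
have nz0 : (q%:R ^+ 3 - 1 : rat)%R != 0%R.
  by rewrite subr_eq0 gt_eqF // -[ltLHS](expr0 q%:R%R) ltr_eXn2l.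
have e0 : #|between 0%VS U 3| = (q ^ 4 + q ^ 3 + q ^ 2 + q + 1) * (q ^ 2 + 1).
  apply/eqP; rewrite -(eqr_nat rat) card_between ?sub0v ?d0 // dU /gauss.
  rewrite big_ltn // big_ltn // big_ltn // big_geq // natrM !natrD !natrX; apply/eqP;
    field.
  by rewrite nz2 nz1 nz0.
have e1 : #|between P U 3| = (q ^ 2 + 1) * (q ^ 2 + q + 1).
  apply/eqP; rewrite -(eqr_nat rat) card_between ?dP // dU /gauss.
  rewrite big_ltn // big_ltn // big_geq // natrM !natrD !natrX; apply/eqP; field.
  by rewrite nz2 nz1.
move: cB; rewrite e0 e1; move: #|B| => b; nia.
Qed.

(** * Families of planes that no line meets entirely *)

Section NoLineCover.

Variable C : {set {vspace V}}.
Hypotheses (C3 : C \subset subspaces V 3) (mC : meeting C) (n0 : 0 < n).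
Hypothesis nocover : forall U, U != 0%VS -> \dim U <= 2 ->
  exists2 E, E \in C & (U :&: E = 0)%VS.

Let dC E : E \in C -> \dim E = 3.
Proof. by move/(subsetP C3); rewrite inE => /eqP. Qed.

Let escape L : 1 <= \dim L <= 2 -> exists2 E, E \in C & (L :&: E = 0)%VS.
Proof. by case/andP=> L0 L2; apply: nocover; rewrite // -dimv_eq0 -lt0n. Qed.

Lemma deg_noncover L : \dim L = 2 -> deg C L <= npt 3.
Proof.
move=> dL; have [|E EC LE] := @escape L; first by rewrite dL.
by apply: (deg_line C3 dL _ _ LE) => [|W WC]; [rewrite dC | apply: mC].
Qed.

(** Let Q be a point of maximal degree d, and F0 a member. Any other member shares
    a point with F0, and F0 accounts for one member at each of these points, so
    the family has at most 1 + npt 3 * (d - 1) members. Branching from Q and the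
    hypothesis give d <= npt 3 * (q + 1). Not counting F0 repeatedly matters: for
    q = 2 the resulting bound is exactly the claimed one. *)
Lemma few_planes_on_lines : (forall L, \dim L = 2 -> deg C L <= q + 1) ->
  diversity C <= q ^ 3 * (q ^ 3 + q ^ 2 + q + 1).
Proof.
move=> poor; have q1 := q_gt1.
have [P0 dP0] : exists P : {vspace V}, \dim P = 1 by apply: exists_dim.
have [F0 F0C _] : exists2 E, E \in C & (P0 :&: E = 0)%VS by apply: escape; rewrite dP0.
have P0p : P0 \in subspaces V 1 by rewrite inE dP0.
pose Q := [arg max_(x > P0 | x \in subspaces V 1) deg C x].
have [dQ maxQ] : \dim Q = 1 /\ (forall x, \dim x = 1 -> deg C x <= deg C Q).
  rewrite /Q; case: arg_maxnP => // x; rewrite inE => /eqP dx h; split=> // y dy.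
  by apply: h; rewrite inE dy.
have degQ : deg C Q <= npt 3 * (q + 1).
  have [E EC QE] : exists2 E, E \in C & (Q :&: E = 0)%VS by apply: escape; rewrite dQ.
  rewrite -(dC EC); apply: branch => [W WC _|x /pointsP[dx xE]]; first exact: mC.
  apply: poor; rewrite dim_addpoint ?dQ //; apply/negP => xQ.
  exact: (sub_point_cap0 dx QE xQ).
have cC : #|C :\ F0| <= npt 3 * (deg C Q - 1).
  rewrite -(dC F0C) -card_points.
  apply: (@union_bound _ _ _ _ (fun x W => (x <= W)%VS)) => [W|x /pointsP[dx xF0]].
    by rewrite in_setD1 => /andP[_ WC]; apply/meet_point/mC.
  apply: leq_trans (leq_sub2r 1 (maxQ _ dx)).
  rewrite /deg (cardsD1 F0) inE F0C xF0 addKn; apply: eq_leq; apply: eq_card => W.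
  by rewrite !inE andbA.
have := missing_deg C Q; have := diversity_le C dQ.
rewrite (cardsD1 F0 C) F0C; move: cC degQ; rewrite npt3.
move: #|_| (deg _ _) (missing _ _) (diversity _) => c d m v cC degQ vm md.
apply: leq_trans vm _.
case: d => [|d] in cC degQ md *; first by nia.
have : m <= (q ^ 2 + q) * d by nia.
move=> /leq_trans; apply.
have : d <= (q ^ 2 + q + 1) * (q + 1) - 1 by lia.
nia.
Qed.

Section RichLine.

Variables (L E1 : {vspace V}).
Hypotheses (dL : \dim L = 2) (rich : q + 1 < deg C L).
Hypotheses (E1C : E1 \in C) (LE1 : (L :&: E1 = 0)%VS).
Let U := (L + E1)%VS.

Let LU : (L <= U)%VS. Proof. exact: addvSl. Qed.
Let E1U : (E1 <= U)%VS. Proof. exact: addvSr. Qed.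
Let dU : \dim U = 5.
Proof. by rewrite dimv_disjoint_sum // dL dC. Qed.

(** A member through L meets E1 in a point, and a plane is spanned by L and any of
    its points off L. *)
Lemma through_rich_line G : G \in C -> (L <= G)%VS -> (G <= U)%VS.
Proof.
move=> GC LG; have [x /pointsP[dx xE1] xG] := meet_point (mC GC E1C).
have xL : ~~ (x <= L)%VS by apply/negP => xL; apply: (sub_point_cap0 dx LE1 xL).
have -> : G = (L + x)%VS.
  by apply/esym/sub_dim_eq; rewrite ?subv_add ?LG // dim_addpoint // dL dC.
by rewrite subv_add LU (subv_trans xE1).
Qed.

(** The members through L meet E in points of E :&: U, and such a point determines
    the member. A line has only q + 1 points, so E :&: U is the whole plane E. *)
Lemma off_rich_line E : E \in C -> (L :&: E = 0)%VS -> (E <= U)%VS.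
Proof.
move=> EC LE; suff d3 : 3 <= \dim (E :&: U).
  by apply: sub_of_dim_cap; rewrite dC.
rewrite ltnNge; apply/negP=> d2.
suff : deg C L <= npt 2 * 1 by rewrite npt2; lia.
apply: leq_trans (_ : npt (\dim (E :&: U)) * 1 <= _); last by rewrite !muln1 leq_npt.
rewrite -card_points; apply: (@union_bound _ _ _ _ (fun x W => (x <= W)%VS)) => [G|x].
  rewrite inE => /andP[GC LG]; have [x /pointsP[dx xE] xG] := meet_point (mC GC EC).
  exists x => //; apply/pointsP; split=> //; rewrite subv_cap xE.
  exact: subv_trans (through_rich_line GC LG).
case/pointsP=> dx; rewrite subv_cap => /andP[xE _].
have xL : ~~ (x <= L)%VS by apply/negP => xL; apply: (sub_point_cap0 dx LE xL).
apply: leq_trans (@deg_plane C (L + x)%VS C3 _); last by rewrite dim_addpoint // dL.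
by apply: eq_leq; apply: eq_card => G; rewrite !inE subv_add andbA.
Qed.

(** By the two preceding lemmas H neither contains L nor is disjoint from it. If the
    trace on U were only the point H :&: L, the plane E1, which lies in U, would
    meet H on L, although it is disjoint from L. *)
Lemma traces_outside H : H \in C -> ~~ (H <= U)%VS ->
  \dim (H :&: L) = 1 /\ \dim (H :&: U) = 2.
Proof.
move=> HC HU.
have dHL : \dim (H :&: L) = 1.
  apply/eqP; rewrite eqn_leq lt0n dimv_eq0 -ltnS andbC.
  rewrite (contraNneq _ HU); last by rewrite capvC => /(off_rich_line HC).
  rewrite -dL ltn_neqAle dimvS ?capvSr // andbT; apply: contra HU => /eqP d2.
  by apply: through_rich_line => //; apply: sub_of_dim_cap; rewrite capvC d2.
split=> //; apply/eqP; rewrite eqn_leq; apply/andP; split.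
  rewrite -ltnS -(dC HC) ltn_neqAle dimvS ?capvSl // andbT.
  apply: contra HU => /eqP d3.
  by apply: sub_of_dim_cap; rewrite d3.
rewrite ltnNge; apply/negP => d1.
have eqHL : (H :&: L = H :&: U)%VS by apply: sub_dim_eq; rewrite ?capvS ?dHL.
have [x /pointsP[dx xE1] xH] := meet_point (mC HC E1C).
apply: (sub_point_cap0 dx LE1 _ xE1).
have : (x <= H :&: U)%VS by rewrite subv_cap xH (subv_trans xE1).
by rewrite -eqHL subv_cap => /andP[].
Qed.

(** Let h0 be the trace of H0 on U, Q its point on L, and let H1 be a member
    disjoint from h0; H1 is not inside U either, so it has a trace h1, a line. A
    member inside U missing Q contains the join of one of q points of h0 and a
    point of h1. A member not inside U and missing Q has as trace on U the join g
    of one of q points of L and a point of E1, and it is determined by g and a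
    further point outside U of a member disjoint from g, which leaves q^2
    choices. *)
Lemma missing_rich_line H0 : H0 \in C -> ~~ (H0 <= U)%VS ->
  exists2 Q, \dim Q = 1 & missing C Q <= q * npt 3 * (q ^ 2 + q + 1).
Proof.
move=> H0C H0U; have [dQ dh0] := traces_outside H0C H0U.
set Q := (H0 :&: L)%VS in dQ; set h0 := (H0 :&: U)%VS in dh0.
exists Q => //.
have [|H1 H1C h01] := @escape h0; first by rewrite dh0.
have H1U : ~~ (H1 <= U)%VS.
  apply/negP => H1U; have [x /pointsP[dx xH1] xH0] := meet_point (mC H0C H1C).
  by apply: (sub_point_cap0 dx h01 _ xH1); rewrite subv_cap xH0 (subv_trans xH1).
have [_ dh1] := traces_outside H1C H1U; set h1 := (H1 :&: U)%VS in dh1.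
have Qh0 : Q \in points h0 by apply/pointsP; rewrite capvS.
have QL : Q \in points L by apply/pointsP; rewrite capvSr.
pose I := [set W in C | ~~ (Q <= W)%VS && (W <= U)%VS].
pose O := [set W in C | ~~ (Q <= W)%VS && ~~ (W <= U)%VS].
have IC : I \subset C by apply/subsetP=> W; rewrite inE => /andP[].
have OC : O \subset C by apply/subsetP=> W; rewrite inE => /andP[].
have cI : #|I| <= q * ((q + 1) * npt 3).
  have -> : q = #|points h0 :\ Q| by rewrite cards_points_but // dh0 npt2 addnK.
  rewrite [in X in _ <= _ * X]cards_points_but // dh0 npt2 addnK.
  apply: (@union_bound _ _ _ _ (fun x W => (x <= W)%VS)) => [W|x].
    rewrite inE => /and3P[WC QW WU]; have [x /pointsP[dx xH0] xW] :=
      meet_point (mC WC H0C).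
    exists x => //; rewrite in_setD1; apply/andP; split.
      by apply: contraNneq QW => <-.
    by apply/pointsP; rewrite subv_cap xH0 (subv_trans xW).
  rewrite in_setD1 => /andP[_ /pointsP[dx xh0]].
  have -> : q + 1 = #|points h1| by rewrite card_points dh1 npt2.
  apply: (@union_bound _ _ _ _ (fun y W => (y <= W)%VS)) => [W|y /pointsP[dy yh1]].
    rewrite inE => /andP[/[!inE]/and3P[WC _ WU] xW].
    have [y /pointsP[dy yH1] yW] := meet_point (mC WC H1C).
    by exists y => //; apply/pointsP; rewrite subv_cap yH1 (subv_trans yW).
  have xy : x != y.
    apply: contraTneq xh0 => ->; apply/negP => yh0; apply: (sub_point_cap0 dy h01 yh0).
    by apply: subv_trans yh1 (capvSl _ _).
  apply: leq_trans _ (deg_noncover (dim_join_points dx dy xy)).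
  apply: subset_leq_card; apply/subsetP=> W; rewrite !inE.
  by move=> /andP[/andP[/andP[-> _] gW] wW]; rewrite subv_add gW wW.
have cO : #|O| <= q * (npt 3 * q ^ 2).
  have -> : q = #|points L :\ Q| by rewrite cards_points_but // dL npt2 addnK.
  rewrite [in X in _ <= _ * (_ * X ^ _)]cards_points_but // dL npt2 addnK.
  apply: (@union_bound _ _ _ _ (fun y W => (y <= W)%VS)) => [W|y].
    rewrite inE => /and3P[WC QW WU]; have [dWL _] := traces_outside WC WU.
    exists (W :&: L)%VS; last exact: capvSl.
    rewrite in_setD1; apply/andP; split; last by apply/pointsP; rewrite capvSr.
    by apply: contraNneq QW => <-; apply: capvSl.
  rewrite in_setD1 => /andP[_ /pointsP[dy yL]].
  rewrite -(dC E1C) -card_points.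
  apply: (@union_bound _ _ _ _ (fun z W => (z <= W)%VS)) => [W|z /pointsP[dz zE1]].
    by rewrite inE => /andP[/[!inE]/and3P[WC _ _] _]; apply/meet_point/mC.
  have yz : y != z.
    by apply: contraTneq yL => ->; apply/negP => zL; apply: (sub_point_cap0 dz LE1 zL).
  have dg := dim_join_points dy dz yz; set g := (y + z)%VS in dg.
  have gU : (g <= U)%VS by rewrite subv_add (subv_trans yL) ?(subv_trans zE1).
  have -> : [set W in [set W in O | (y <= W)%VS] | (z <= W)%VS] = [set W in O | (g <=
    W)%VS].
    by apply/setP=> W; rewrite !inE subv_add !andbA.
  have [|H HC gH] := @escape g; first by rewrite dg.
  (* a plane with trace g on U meets H only outside U *)
  have trace W : W \in O -> (g <= W)%VS -> (W :&: U = g)%VS.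
    rewrite inE => /and3P[WC _ WU] gW; apply/esym/sub_dim_eq.
      by rewrite subv_cap gW.
    by rewrite (traces_outside WC WU).2 dg.
  (* H has npt 3 - npt 2 = q^2 points outside U, or none if H lies in U *)
  pose B := points H :\: points (H :&: U)%VS.
  have cB : #|B| <= q ^ 2.
    have sub : points (H :&: U)%VS \subset points H.
      apply/subsetP=> x /pointsP[dx]; rewrite subv_cap => /andP[xH _].
      exact/pointsP.
    rewrite cardsDS // !card_points (dC HC).
    have [HU|HU] := boolP (H <= U)%VS; first by rewrite (capv_idPl HU) dC // subnn.
    by rewrite (traces_outside HC HU).2 npt2 npt3 -addnA addnK.
  rewrite -[leqRHS]muln1; apply: leq_trans (_ : #|B| * 1 <= _);
    last by rewrite leq_mul2r cB.
  apply: (@union_bound _ _ _ _ (fun w W => (w <= W)%VS)) => [W|w].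
    rewrite inE => /andP[WO gW]; have WC := subsetP OC _ WO.
    have [w wH wW] := meet_point (mC WC HC); exists w => //.
    rewrite inE wH andbT; apply/negP => /pointsP[dw]; rewrite subv_cap => /andP[wH' wU].
    by apply: (sub_point_cap0 dw gH _ wH'); rewrite -(trace _ WO gW) subv_cap wW.
  rewrite inE => /andP[_ /pointsP[dw wH]].
  have wg : ~~ (w <= g)%VS by apply/negP => wg; apply: (sub_point_cap0 dw gH wg).
  apply: leq_trans (@deg_plane C (g + w)%VS C3 _); last by rewrite dim_addpoint // dg.
  apply: subset_leq_card; apply/subsetP=> W; rewrite !inE.
  by move=> /andP[/andP[/andP[-> _] gW] wW]; rewrite subv_add gW wW.
apply: leq_trans (_ : #|I :|: O| <= _).
  apply: subset_leq_card; apply/subsetP=> W; rewrite !inE => /andP[-> ->] /=.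
  by case: (W <= U)%VS.
apply: leq_trans (leq_card_setU _ _) _; apply: leq_trans (leq_add cI cO) _.
by apply: eq_leq; ring.
Qed.

Lemma rich_line_bound : diversity C <= q ^ 3 * (q ^ 3 + q ^ 2 + q + 1).
Proof.
have q1 := q_gt1.
have [/forall_inP allU|] := boolP [forall W in C, (W <= U)%VS].
  have [P dP PL] : exists2 P, \dim P = 1 & (P <= L)%VS.
    by apply: exists_point; rewrite -dimv_eq0 dL.
  apply: leq_trans (diversity_le C dP) _.
  by apply: missing_in_5space dU (subv_trans PL LU) C3 allU.
rewrite negb_forall_in => /exists_inP[H0 H0C H0U].
have [Q dQ mQ] := missing_rich_line H0C H0U.
apply: leq_trans (diversity_le C dQ) (leq_trans mQ _).
rewrite npt3; nia.
Qed.

End RichLine.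

Lemma no_line_cover_bound : diversity C <= q ^ 3 * (q ^ 3 + q ^ 2 + q + 1).
Proof.
have [/forallP poor|] := boolP [forall L : {vspace V},
  (\dim L == 2) ==> (deg C L <= q + 1)].
  by apply: few_planes_on_lines => L dL; have := poor L; rewrite dL.
rewrite negb_forall => /existsP[L]; rewrite negb_imply -ltnNge => /andP[/eqP dL rich].
have [|E1 E1C LE1] := @escape L; first by rewrite dL.
exact: rich_line_bound dL rich E1C LE1.
Qed.

End NoLineCover.

(** The bound q^3 (q^3 + q^2 + q + 1) used in the absence of a triangle of
    lines is the diversity of G2 for n = 7, and is below it for larger n. *)
Lemma diversity_planes A : 7 <= n -> A \subset subspaces V 3 -> meeting A ->
  diversity A <= q ^ 2 * (thru 2 3 - thru 3 3).
Proof.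
move=> n7 A3 mA; have q1 := q_gt1.
have pt : exists P : {vspace V}, \dim P = 1 by apply: exists_dim; lia.
have D_le : q ^ 3 * (q ^ 3 + q ^ 2 + q + 1) <= q ^ 2 * (thru 2 3 - thru 3 3).
  rewrite thru_id expnS -mulnA mulnCA leq_mul2l; apply/orP; right.
  have := @thru_rec 2 3 isT ltac:(lia); rewrite thru_id muln1 => e.
  have le7 : q ^ 7 <= q ^ n by rewrite leq_exp2l.
  suff : q * (q ^ 3 + q ^ 2 + q + 1) + 1 <= thru 2 3 by lia.
  have q3 : 0 < q ^ 3 - q ^ 2 by rewrite subn_gt0 ltn_exp2l.
  rewrite -(leq_pmul2r q3) e; apply: leq_trans (leq_sub2r _ le7).
  by apply: eq_leq; rewrite mulnBr; nia.
have [|C AC satC] := @saturate 3 A _ mA.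
  by move=> U /(subsetP A3); rewrite inE => /eqP->.
have [dC mC sat] := satC; have mCA U T : U \in A -> T \in C -> (U :&: T)%VS != 0%VS.
  by move/(subsetP AC) => UC; apply: mC.
have [/existsP[Q /andP[QC /eqP dQ]]|] := boolP [exists Q : {vspace V},
  (Q \in C) && (\dim Q == 1)].
  apply: leq_trans (diversity_le A dQ) _; rewrite (_ : missing A Q = 0) //.
  apply/eqP; rewrite cards_eq0; apply/eqP/setP => U; rewrite !inE; apply/negP.
  by case/andP=> UA; rewrite -meet_pointE // capvC mCA.
rewrite negb_exists => /forallP noPt.
have dC2 T : T \in C -> \dim T <= 2 -> \dim T = 2.
  move=> TC T2; apply/eqP; rewrite eqn_leq T2 /=.
  have := noPt T; rewrite TC /=; have := meeting_neq0 mC TC; rewrite -dimv_eq0; lia.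
pose C2 := [set T in C | \dim T <= 2].
have C2C : C2 \subset C by apply/subsetP=> T; rewrite inE => /andP[].
have le2 T : T \in C2 -> \dim T <= 2 by rewrite inE => /andP[].
have [[P dP PC]|[Y [dY CY avoid]]] :=
  lines_concurrent_or_coplanar pt le2 (meetingS C2C mC).
- have [C20|[T]] := set_0Vmem C2.
    apply: leq_trans (diversityS pt AC) _; apply: leq_trans D_le.
    have big U : U \in C -> 2 < \dim U.
      by move=> UC; rewrite ltnNge; apply/negP => U2; have := in_set0 U;
        rewrite -C20 inE UC U2.
    apply: no_line_cover_bound => // [||U U0 U2]; last 1 first.
    + by apply: sat => //; [lia | apply/negP => /big; lia].
    + by apply/subsetP=> U UC; rewrite inE eqn_leq dC //= big.
    + by lia.
  rewrite inE => /andP[TC T2].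
  have noPt' Q : \dim Q = 1 -> Q \notin C.
    by move=> dQ; have := noPt Q; rewrite dQ eqxx andbT.
  have thr L : L \in C -> \dim L = 2 -> (P <= L)%VS by move=> LC dL; apply: PC;
    rewrite inE LC dL.
  apply: leq_trans (diversity_le A dP) _; apply: leq_trans D_le.
  apply: leq_trans (missing_line_cover satC AC A3 dP TC (dC2 _ TC T2) noPt' thr) _.
  rewrite npt3; nia.
have C20 : C2 != set0 by case: pt => P0 /avoid[T TC _]; apply/set0Pn; exists T.
apply: leq_trans (diversityS pt _) (diversity_G2_le 3 dY).
apply/subsetP=> U UA; rewrite inE (subsetP A3) //=.
apply: (meets_triangle (meetingS C2C mC)) C20 CY avoid _ => T /(subsetP C2C).
exact: mCA.
Qed.

Lemma diversity_lines A : 1 <= n -> A \subset subspaces V 2 -> meeting A ->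
  diversity A <= q ^ 2 * (thru 2 2 - thru 3 2).
Proof.
move=> n1 A2 mA; have pt : exists P : {vspace V}, \dim P = 1 by apply: exists_dim.
have d2 T : T \in A -> \dim T = 2 by move/(subsetP A2); rewrite inE => /eqP.
have le2 T : T \in A -> \dim T <= 2 by move/d2->.
have [[P dP PA]|[Y [dY AY avoid]]] := lines_concurrent_or_coplanar pt le2 mA.
- apply: leq_trans (diversity_le A dP) _; rewrite (_ : missing A P = 0) //.
  apply/eqP; rewrite cards_eq0; apply/eqP/setP => U; rewrite !inE; apply/negP.
  by case/andP=> /PA->.
apply: leq_trans (diversityS pt _) (diversity_G2_le 2 dY).
apply/subsetP=> U UA; rewrite inE (subsetP A2) //=.
by have [dU /capv_idPl->] := AY _ UA; rewrite dU.
Qed.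

(** * Numerical estimates for k at least 4 *)

(** These inequalities have the form i (i - 1) + D <= 2 + m (i - 2), where i = u + 3
    and k = i + v, and m = n - k is bounded below by the relevant hypotheses. The
    number D is the gain proved for the i-th peeling term, at most the exact
    exponent (i - 2) (m - i - 1); its choice depends on the range:
    D = k - 2 when n >= 2 k + 2, D = (k - 1) + (i - 3) when n >= 2 k + 3, and
    D = i + max (6, k - 4) when moreover n - k >= 13. *)
Lemma peel_exponent_basic u v d :
  (u + 3) * (u + 3).-1 + (u + v + 1) <= 2 + (u + v + 5 + d) * (u + 3 - 2).
Proof.
have -> : (u + 3).-1 = u + 2 by lia.
have -> : u + 3 - 2 = u + 1 by lia.
nia.
Qed.

Lemma peel_exponent_wide u v d :
  (u + 3) * (u + 3).-1 + (u + v + 2 + (u + 3 - 3)) <= 2 + (u + v + 6 + d) * (u + 3 - 2).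
Proof.
rewrite addnK; have -> : (u + 3).-1 = u + 2 by lia.
have -> : u + 3 - 2 = u + 1 by lia.
nia.
Qed.

Lemma peel_exponent_small_k u d : 7 <= u + d ->
  (u + 3) * (u + 3).-1 + (u + 3 + 6) <= 2 + (u + d + 6) * (u + 3 - 2).
Proof.
have -> : (u + 3).-1 = u + 2 by lia.
have -> : u + 3 - 2 = u + 1 by lia.
nia.
Qed.

Lemma peel_exponent_large_k u v d : v <= d -> 1 <= u + v ->
  (u + 3) * (u + 3).-1 + (u + 3 + (u + v - 1)) <= 2 + (u + d + 6) * (u + 3 - 2).
Proof.
move=> vd uv; have -> : (u + 3).-1 = u + 2 by lia.
have -> : u + 3 - 2 = u + 1 by lia.
have -> : u + 3 + (u + v - 1) = u + u + v + 2 by lia.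
nia.
Qed.

Section Numeric.

Variable k : nat.
Hypothesis kn : k + 2 <= n.
Local Open Scope ring_scope.
Local Notation Q := (q%:R : rat).
Local Notation t i := ((thru i k)%:R : rat).
Local Notation p i := ((npt i)%:R : rat).
Local Notation r := (Q / (Q - 1)).
Local Notation s := ((Q - 1)^-1).

Lemma Q_ge2 : 2 <= Q.
Proof. by rewrite ler_nat q_gt1. Qed.

Lemma npt_le i : (0 < i)%N -> p i <= r * Q ^+ i.-1.
Proof.
case: i => // i _; have Q2 := Q_ge2; have := npt_mul i.+1.
have q1 := q_gt1.
move=> /(congr1 (fun a : nat => a%:R : rat)); rewrite natrM !natrB ?expn_gt0;
  rewrite ?(ltnW q1) // natrX => e.
rewrite mulrAC -exprS ler_pdivlMr ?e ?subr_gt0; lra.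
Qed.

(** From npt i <= r q^(i-1) and q^((n-k)(i-2)) thru i k <= thru 2 k. *)
Lemma peel_term_powQ_le i D : (2 <= i <= k)%N ->
  (i * i.-1 + D <= 2 + (n - k) * (i - 2))%N ->
  p i ^+ i * t i * Q ^+ D <= r ^+ i * Q ^+ 2 * t 2.
Proof.
move=> /andP[i2 ik] h; have Q2 := Q_ge2.
have r0 : 0 <= r by rewrite divr_ge0; lra.
have ti : Q ^+ ((n - k) * (i - 2)) * t i <= t 2.
  rewrite -natrX -natrM ler_nat -{2}(subnKC i2); apply: thru_ratioX; lia.
apply: le_trans (_ : r ^+ i * Q ^+ 2 * (Q ^+ ((n - k) * (i - 2)) * t i) <= _);
  last first.
  by rewrite ler_wpM2l // mulr_ge0 ?exprn_ge0 //; lra.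
apply: le_trans (_ : (r * Q ^+ i.-1) ^+ i * t i * Q ^+ D <= _).
  apply: ler_wpM2r; first by rewrite exprn_ge0.
  apply: ler_wpM2r; first by [].
  rewrite lerXn2r ?nnegrE ?ler0n //.
    by rewrite mulr_ge0 ?exprn_ge0 //; lra.
  by apply: npt_le; lia.
rewrite exprMn -exprM -!mulrA ler_wpM2l ?exprn_ge0 //.
rewrite [t i * _]mulrC !mulrA -!exprD ler_wpM2r ?ler0n // mulnC -expr2 -exprD.
by rewrite ler_weXn2l //; lra.
Qed.

Lemma peel_term_le i D b : (2 <= i <= k)%N ->
    (i * i.-1 + D <= 2 + (n - k) * (i - 2))%N -> r ^+ i <= b * Q ^+ D ->
  p i ^+ i * t i <= b * (Q ^+ 2 * t 2).
Proof.
move=> ik hD hb; have Q2 := Q_ge2.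
have QD : 0 < Q ^+ D by rewrite exprn_gt0 //; lra.
rewrite -(ler_pM2r QD) [leRHS]mulrAC.
apply: le_trans (peel_term_powQ_le ik hD) _; rewrite -mulrA.
by apply: ler_wpM2r hb; rewrite mulr_ge0 ?exprn_ge0.
Qed.

Lemma off_member_term_le d : (0 < k)%N -> (k.-1 + d <= n - k)%N -> (2 <= k)%N ->
  p k * t 3 <= r / Q ^+ d * t 2.
Proof.
move=> k0 h k2; have Q2 := Q_ge2.
have r0 : 0 <= r by rewrite divr_ge0; lra.
have Qd : 0 < Q ^+ d by rewrite exprn_gt0; lra.
have t3 : Q ^+ (n - k) * t 3 <= t 2.
  by rewrite -natrX -natrM ler_nat; apply: thru_ratio; lia.
rewrite mulrAC ler_pdivlMr // -[p k * _ * _]mulrA.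
apply: le_trans (_ : r * Q ^+ k.-1 * (t 3 * Q ^+ d) <= _).
  by rewrite ler_wpM2r ?npt_le // mulr_ge0 ?ler0n // ltW.
rewrite -mulrA ler_wpM2l //; apply: le_trans t3.
rewrite [t 3 * _]mulrC mulrA -exprD ler_wpM2r ?ler0n //.
by rewrite ler_weXn2l //; lra.
Qed.

Lemma loss_le b c : (3 <= k)%N ->
    (forall i, (3 <= i <= k)%N -> p i ^+ i * t i <= b * (Q ^+ 2 * t 2)) ->
    p k * t 3 <= c * t 2 ->
  (\sum_(3 <= i < k.+1) npt i ^ i * thru i k + q ^ 2 * npt k * thru 3 k)%N%:R <=
    ((k - 2)%N%:R * b + c) * (Q ^+ 2 * t 2).
Proof.
move=> k3 hb hc; rewrite natrD natr_sum mulrDl; apply: lerD; last first.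
  rewrite 2!natrM natrX -mulrA [c * _]mulrCA ler_wpM2l // exprn_ge0 //.
apply: le_trans (_ : \sum_(3 <= i < k.+1) b * (Q ^+ 2 * t 2) <= _).
  rewrite big_nat [leRHS]big_nat; apply: ler_sum => i /andP[i3 ik].
  by rewrite natrM natrX; apply: hb; rewrite i3.
rewrite sumr_const_nat -[leLHS]mulr_natl mulrA; have -> : (k.+1 - 3 = k - 2)%N by lia.
by [].
Qed.

(** j x^j decreases with j, because (j + 1) x <= j for j >= 1 and x <= 1/2. *)
Lemma mul_exp_le (x : rat) j0 j : 0 <= x <= 1/2 -> (0 < j0)%N -> (j0 <= j)%N ->
  j%:R * x ^+ j <= j0%:R * x ^+ j0.
Proof.
move=> /andP[x0 x1] j00 /subnK <-; elim: (j - j0)%N => // d IH.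
apply: le_trans IH; rewrite addSn exprS mulrA ler_wpM2r ?exprn_ge0 //.
have : 1 <= (d + j0)%N%:R :> rat by rewrite ler1n; lia.
rewrite -natr1; nra.
Qed.

Lemma thru3_le2 : (2 <= k)%N -> (thru 3 k <= thru 2 k)%N.
Proof.
move=> k2; apply: leq_trans _ (@thru_ratio 2 k k2 _); last by lia.
by rewrite leq_pmull // expn_gt0 (ltnW (q_gt1)).
Qed.

Lemma powQ_thru3_le d : (2 <= k)%N -> (d <= n - k)%N -> Q ^+ d * t 3 <= t 2.
Proof.
move=> k2 dn; have Q2 := Q_ge2; apply: le_trans (_ : Q ^+ (n - k) * t 3 <= _).
  by rewrite ler_wpM2r ?ler0n // ler_weXn2l //; lra.
by rewrite -natrX -natrM ler_nat; apply: thru_ratio; lia.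
Qed.

Local Notation loss :=
  (\sum_(3 <= i < k.+1) npt i ^ i * thru i k + q ^ 2 * npt k * thru 3 k)%N.

Lemma loss_le_basic : (3 <= k)%N -> (2 * k + 2 <= n)%N ->
  loss%:R <= ((k - 2)%N%:R * (r ^+ 2 * s ^+ (k - 2)) + r / Q ^+ 3) * (Q ^+ 2 * t 2).
Proof.
move=> k3 nk; have Q2 := Q_ge2.
apply: loss_le => // [i /andP[i3 ik]|]; last by apply: off_member_term_le; lia.
apply: (@peel_term_le i (k - 2)).
- by rewrite ik (ltnW i3).
- have [u iE] : exists u, i = (u + 3)%N by exists (i - 3)%N; lia.
  have [v vk] : exists v, k = (i + v)%N by exists (k - i)%N; lia.
  have [d dE] : exists d, (n - k = u + v + 5 + d)%N.
    by exists (n - k - (u + v + 5))%N; lia.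
  have -> : (k - 2 = u + v + 1)%N by lia.
  by rewrite dE iE; apply: peel_exponent_basic.
- have r1 : 1 <= r by rewrite ler_pdivlMr; lra.
  rewrite -mulrA -exprMn [s * Q]mulrC -exprD subnKC ?(ltnW k3) //.
  by rewrite ler_weXn2l.
Qed.

Lemma r_le : r <= 2.
Proof. have Q2 := Q_ge2; rewrite ler_pdivrMr; lra. Qed.

Lemma r_ge0 : 0 <= r.
Proof. have Q2 := Q_ge2; rewrite divr_ge0; lra. Qed.

Lemma rX_le i : r ^+ i <= Q ^+ i.
Proof.
have Q2 := Q_ge2; have rl := r_le; have r0 := r_ge0.
by rewrite lerXn2r ?nnegrE //; lra.
Qed.

Lemma invQ_expK d e : Q^-1 ^+ d * Q ^+ (d + e) = Q ^+ e.
Proof.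
by rewrite exprD mulrA -exprMn mulVf ?expr1n ?mul1r // pnatr_eq0; have := q_gt1; lia.
Qed.

(** The extra factor q^-(i-3), compared to the basic range, compensates r^(i-3). *)
Lemma loss_wide : (4 <= k)%N -> (2 * k + 3 <= n)%N ->
  loss%:R <= ((k - 2)%N%:R * (r ^+ 3 * Q^-1 ^+ (k - 1)) + r / Q ^+ 4) * (Q ^+ 2 * t 2).
Proof.
move=> k3 nk; apply: loss_le => [|i /andP[i3 ik]|];
  try by [apply: off_member_term_le; lia | lia].
apply: (@peel_term_le i (k - 1 + (i - 3))).
- by rewrite ik (ltnW i3).
- have [u iE] : exists u, i = (u + 3)%N by exists (i - 3)%N; lia.
  have [v vk] : exists v, k = (i + v)%N by exists (k - i)%N; lia.
  have [d dE] : exists d, (n - k = u + v + 6 + d)%N.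
    by exists (n - k - (u + v + 6))%N; lia.
  have -> : (k - 1 = u + v + 2)%N by lia.
  by rewrite dE iE; apply: peel_exponent_wide.
- rewrite -mulrA invQ_expK; have -> : r ^+ i = r ^+ 3 * r ^+ (i - 3)
  by rewrite -exprD subnKC.
  by rewrite ler_wpM2l ?exprn_ge0 ?r_ge0 ?rX_le.
Qed.

(** For q = 2 one has r = 2, and r^i is no longer negligible: it is absorbed by
    asking for the gain q^i on top of q^e. Near i = 3 this gain comes from
    n - k >= 13, near i = k from n >= 2 k + 3. *)
Lemma loss_wider (e := maxn 6 (k - 4)) : (4 <= k)%N -> (2 * k + 3 <= n)%N ->
  (13 <= n - k)%N ->
  loss%:R <= ((k - 2)%N%:R * (Q^-1 ^+ e) + r / Q ^+ 4) * (Q ^+ 2 * t 2).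
Proof.
move=> k3 nk nk13.
apply: loss_le => [|i /andP[i3 ik]|]; try by [apply: off_member_term_le; lia | lia].
apply: (@peel_term_le i (i + e)).
- by rewrite ik (ltnW i3).
- have [u iE] : exists u, i = (u + 3)%N by exists (i - 3)%N; lia.
  have [v vk] : exists v, k = (i + v)%N by exists (k - i)%N; lia.
  have [d dE] : exists d, (n - k = u + d + 6)%N by exists (n - k - (u + 6))%N; lia.
  have [e6|e6] : (e = 6 \/ e = k - 4)%N by rewrite /e; lia.
    by rewrite e6 dE iE; apply: peel_exponent_small_k; lia.
  rewrite e6 dE iE (_ : (k - 4 = u + v - 1)%N); last by lia.
  by apply: peel_exponent_large_k; lia.
- by rewrite [(i + e)%N]addnC invQ_expK rX_le.
Qed.

(** The margin 3/4 absorbs [thru 3 k], which is at most a quarter of [thru 2 k]. *)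
Lemma loss_small c : (2 <= k)%N -> loss%:R <= c * (Q ^+ 2 * t 2) -> c <= 3/4 ->
  (loss <= q ^ 2 * (thru 2 k - thru 3 k))%N.
Proof.
move=> k2 h c1; have Q2 := Q_ge2; have t3 := @powQ_thru3_le 2 k2 ltac:(lia).
have t32 := thru3_le2 ltac:(lia).
rewrite -(ler_nat rat) natrM natrB // natrX; apply: le_trans h _.
have t0 : 0 <= t 3 by []. have t0' : 0 <= t 2 by [].
have Q4 : 4 <= Q ^+ 2 by rewrite expr2; nra.
rewrite mulrCA ler_wpM2l ?exprn_ge0 //; nra.
Qed.

Lemma loss_q2 : (4 <= k)%N -> (2 * k + 3 <= n)%N -> (13 <= n - k)%N -> q = 2 ->
  (loss <= q ^ 2 * (thru 2 k - thru 3 k))%N.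
Proof.
move=> k4 nk nk13 q2; apply: loss_small (loss_wider k4 nk nk13) _; first by lia.
set e := maxn 6 (k - 4); have -> : Q = 2 by rewrite q2.
have -> : 2 / (2 - 1) / 2 ^+ 4 = 1 / 8 :> rat by field.
have h1 : (k - 2)%N%:R <= e%:R + 2 :> rat by rewrite -natrD ler_nat /e; lia.
have h2 := @mul_exp_le 2^-1 6 e ltac:(lra) ltac:(lia) ltac:(by rewrite /e; lia).
have h3 : 2^-1 ^+ e <= 2^-1 ^+ 6 :> rat by apply: ler_wiXn2l;
  [lra | lra | rewrite /e; lia].
have h4 : 0 <= 2^-1 ^+ e :> rat by rewrite exprn_ge0 //; lra.
have h6 : 2^-1 ^+ 6 = 1 / 64 :> rat by field.
rewrite h6 in h2 h3; move: h1 h2 h3 h4; clear.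
move: (2^-1 ^+ e) (e%:R) ((k - 2)%N%:R) => x y z; nra.
Qed.

Lemma loss_q3 : (4 <= k)%N -> (2 * k + 3 <= n)%N -> q = 3 ->
  (loss <= q ^ 2 * (thru 2 k - thru 3 k))%N.
Proof.
move=> k4 nk q3; apply: loss_small (loss_wide k4 nk) _; first by lia.
have -> : Q = 3 by rewrite q3.
have -> : 3 / (3 - 1) / 3 ^+ 4 = 1 / 54 :> rat by field.
have -> : (3 / (3 - 1)) ^+ 3 = 27 / 8 :> rat by field.
have h1 : (k - 2)%N%:R <= (k - 1)%N%:R :> rat by rewrite ler_nat; lia.
have h2 := @mul_exp_le 3^-1 3 (k - 1) ltac:(lra) ltac:(lia) ltac:(lia).
have h4 : 0 <= 3^-1 ^+ (k - 1) :> rat by rewrite exprn_ge0 //; lra.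
have h6 : 3^-1 ^+ 3 = 1 / 27 :> rat by field.
rewrite h6 in h2; move: h1 h2 h4; clear.
move: (3^-1 ^+ _) ((k - 1)%N%:R) ((k - 2)%N%:R) => x y z; nra.
Qed.

(** Lowers k - 2 to the least value j allowed in the range considered. *)
Lemma loss_coef_le j : (0 < j)%N -> (j <= k - 2)%N -> 3 <= Q ->
  (k - 2)%N%:R * (r ^+ 2 * s ^+ (k - 2)) + r / Q ^+ 3 <=
    r ^+ 2 * (j%:R * s ^+ j) + r / Q ^+ 3.
Proof.
move=> j0 jk Q3; rewrite lerD2r mulrCA; apply: ler_wpM2l.
  by rewrite exprn_ge0 ?r_ge0.
apply: mul_exp_le => //; rewrite invr_ge0 subr_ge0.
have -> /= : 1 <= Q by lra.
by rewrite div1r lef_pV2 ?posrE; lra.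
Qed.

Lemma loss_q3_k9 : (9 <= k)%N -> (2 * k + 2 <= n)%N -> q = 3 ->
  (loss <= q ^ 2 * (thru 2 k - thru 3 k))%N.
Proof.
move=> k4 nk q3; have Q3 : Q = 3 by rewrite q3.
apply: loss_small (loss_le_basic _ nk) _; try lia.
have h : 3 <= Q by rewrite Q3.
apply: le_trans (@loss_coef_le 7 _ _ h) _; [by [] | lia | rewrite Q3].
rewrite (_ : (3 - 1 : rat) = 2); last by ring.
rewrite (_ : 2^-1 ^+ 7 = 1 / 128 :> rat); last by field.
rewrite (_ : (3 / 2) ^+ 2 = 9 / 4 :> rat); last by field.
by rewrite (_ : 3 / 2 / 3 ^+ 3 = 1 / 18 :> rat); [lra | field].
Qed.

Lemma loss_q4 : (6 <= k)%N -> (2 * k + 2 <= n)%N -> q = 4 ->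
  (loss <= q ^ 2 * (thru 2 k - thru 3 k))%N.
Proof.
move=> k4 nk q4; have Q4 : Q = 4 by rewrite q4.
apply: loss_small (loss_le_basic _ nk) _; try lia.
have h : 3 <= Q by rewrite Q4.
apply: le_trans (@loss_coef_le 4 _ _ h) _; [by [] | lia | rewrite Q4].
rewrite (_ : (4 - 1 : rat) = 3); last by ring.
rewrite (_ : 3^-1 ^+ 4 = 1 / 81 :> rat); last by field.
rewrite (_ : (4 / 3) ^+ 2 = 16 / 9 :> rat); last by field.
by rewrite (_ : 4 / 3 / 4 ^+ 3 = 1 / 48 :> rat); [lra | field].
Qed.

Lemma loss_coef_le2 : (4 <= k)%N -> 4 <= Q ->
  (k - 2)%N%:R * (r ^+ 2 * s ^+ (k - 2)) + r / Q ^+ 3 <=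
    2 * r ^+ 2 * s ^+ 2 + r / Q ^+ 3.
Proof.
move=> k4 Q4; apply: le_trans (@loss_coef_le 2 _ _ _) _; [by [] | lia | lra |].
by rewrite mulrCA mulrA.
Qed.

Lemma loss_q5 : (4 <= k)%N -> (2 * k + 2 <= n)%N -> (5 <= q)%N ->
  (loss <= q ^ 2 * (thru 2 k - thru 3 k))%N.
Proof.
move=> k4 nk q5; have Q5 : 5 <= Q by rewrite ler_nat.
apply: loss_small (loss_le_basic _ nk) _; try lia.
apply: le_trans (loss_coef_le2 k4 _) _; first by lra.
have s0 : 0 <= s by rewrite invr_ge0; lra.
have s4 : s <= 1 / 4 by rewrite div1r lef_pV2 ?posrE; lra.
have r1 : r = 1 + s by field; rewrite subr_eq0 gt_eqF //; lra.
have Q3 : Q ^- 3 <= 1 / 8.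
  rewrite div1r lef_pV2 ?posrE ?exprn_gt0; try lra.
  rewrite (_ : 8 = 2 ^+ 3); last by ring.
  by rewrite lerXn2r ?nnegrE; lra.
have Q0 : 0 <= Q ^- 3 by rewrite invr_ge0 exprn_ge0.
rewrite r1; move: s0 s4 Q3 Q0; clear; move: s (Q ^- 3) => x y x0 x4 y8 y0.
have xx : x ^+ 2 <= 1 / 16 by rewrite expr2; nra.
have xx1 : (1 + x) ^+ 2 <= 25 / 16 by rewrite expr2; nra.
have xx0 : 0 <= x ^+ 2 by rewrite exprn_ge0.
nra.
Qed.

(** As s = r / q, the leading term 2 r^2 s^2 equals 2 r^4 / q^2, well below 2 / q. *)
Lemma loss_q7 : (4 <= k)%N -> (2 * k + 2 <= n)%N -> (7 <= q)%N ->
  loss%:R <= 2 * Q^-1 * (q ^ 2 * (thru 2 k - thru 3 k))%N%:R.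
Proof.
move=> k4 nk q7; have Q7 : 7 <= Q by rewrite ler_nat.
apply: le_trans (loss_le_basic _ nk) _; first by lia.
have t3 := @powQ_thru3_le 2 ltac:(lia) ltac:(lia).
have t32 := thru3_le2 ltac:(lia).
rewrite natrM (natrB _ t32) natrX [leRHS]mulrCA [leLHS]mulrCA ler_wpM2l ?exprn_ge0 //.
apply: le_trans (_ : (2 * r ^+ 2 * s ^+ 2 + r / Q ^+ 3) * t 2 <= _).
  by rewrite ler_wpM2r // loss_coef_le2 //; lra.
have t0 : 0 <= t 3 by []. have t0' : 0 <= t 2 by [].
have Q4 : 4 <= Q ^+ 2 by rewrite expr2; nra.
apply: le_trans (_ : 2 * Q^-1 * (3 / 4 * t 2) <= _); last first.
  by rewrite ler_wpM2l ?mulr_ge0 ?invr_ge0 //; nra.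
rewrite mulrA ler_wpM2r //.
have s0 : 0 <= s by rewrite invr_ge0; lra.
have s4 : s <= 1 / 6 by rewrite div1r lef_pV2 ?posrE; lra.
have r1 : r = 1 + s by field; rewrite subr_eq0 gt_eqF //; lra.
have sE : s = Q^-1 * (1 + s).
  by field; rewrite subr_eq0 !gt_eqF //; lra.
have y0 : 0 <= Q^-1 by rewrite invr_ge0.
have y7 : Q^-1 <= 1 / 7 by rewrite div1r lef_pV2 ?posrE; lra.
rewrite r1 -exprVn; move: s0 s4 sE y0 y7; clear; move: s (Q^-1) => x y x0 x6 xE y0 y7.
rewrite [in x ^+ 2]xE.
have -> : 2 * (1 + x) ^+ 2 * (y * (1 + x)) ^+ 2 + (1 + x) * y ^+ 3
   = y * (2 * (1 + x) ^+ 4 * y + (1 + x) * y ^+ 2) by ring.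
have -> : 2 * y * (3 / 4) = y * (3 / 2) by field.
apply: ler_wpM2l => //.
have h2 : (1 + x) ^+ 2 <= 49 / 36 by rewrite expr2; nra.
have h4 : (1 + x) ^+ 4 <= 2.
  have u0 : 0 <= (1 + x) ^+ 2 by rewrite exprn_ge0 //; lra.
  by rewrite (exprM _ 2 2); move: h2 u0; move: (_ ^+ 2) => u; rewrite expr2; nra.
have h40 : 0 <= (1 + x) ^+ 4 by rewrite exprn_ge0 //; lra.
have y2 : y ^+ 2 <= 1 / 49 by rewrite expr2; nra.
have y20 : 0 <= y ^+ 2 by rewrite exprn_ge0.
nra.
Qed.

End Numeric.

(** * Assembling the bounds *)

Lemma diversity_points (A : {set {vspace V}}) :
  1 <= n -> A \subset subspaces V 1 -> meeting A -> diversity A = 0.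
Proof.
move=> n1 A1 mA; have [P0 dP0] : exists P : {vspace V}, \dim P = 1 by apply: exists_dim.
have [A0|[P PA]] := set_0Vmem A.
  by apply/eqP; rewrite -leqn0 A0 /diversity cards0.
have dA U : U \in A -> \dim U = 1 by move/(subsetP A1); rewrite inE => /eqP.
apply/eqP; rewrite -leqn0; apply: leq_trans (diversity_le A (dA _ PA)) _.
rewrite leqn0 cards_eq0; apply/eqP/setP => U; rewrite !inE; apply/negP.
by case/andP=> UA; rewrite -meet_pointE ?dA // mA.
Qed.

(** If A is inside a G2 then monotonicity suffices, as the diversity of G2 does not
    depend on the 3-space. *)
Lemma diversity_large (A : {set {vspace V}}) k (X : {vspace V}) :
    4 <= k -> k + 2 <= n -> A \subset subspaces V k -> meeting A -> \dim X = 3 ->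
    (\sum_(3 <= i < k.+1) npt i ^ i * thru i k + q ^ 2 * npt k * thru 3 k
      <= q ^ 2 * (thru 2 k - thru 3 k)) ->
  diversity A <= diversity (G2 k X).
Proof.
move=> k4 kn Ak mA dX small.
apply: leq_trans _ (diversity_G2_ge dX _ kn); last by lia.
have [/existsP[Y /andP[/eqP dY AY]]|notG2] :=
    boolP [exists Y : {vspace V}, (\dim Y == 3) && (A \subset G2 k Y)].
  apply: leq_trans (diversityS _ AY) (diversity_G2_le k dY).
  by apply: exists_dim; lia.
apply: leq_trans (diversity_not_in_G2 Ak mA _ _) small; first by lia.
move=> Y dY AY; move/negP: notG2; apply; apply/existsP; exists Y.
by rewrite dY AY.
Qed.

End Subspaces.

Theorem theorem4p4 (F : finFieldType) (q n k : nat) (X : {vspace 'rV[F]_n})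
  (hq : #|F| = q) (hn : 0 < n) (hk : 0 < k) (hX : \dim X = 3) :
  ((k = 2 /\ 2 * k <= n) \/
   (k = 3 /\ 2 * k + 1 <= n) \/
   (5 <= q /\ 4 <= k /\ 2 * k + 2 <= n) \/
   (q = 4 /\ 6 <= k /\ 2 * k + 2 <= n) \/
   (q = 3 /\ 9 <= k /\ 2 * k + 2 <= n) \/
   (q = 3 /\ 2 * k + 3 <= n /\ 9 <= n - k) \/
   (q = 2 /\ 4 <= k /\ 2 * k + 3 <= n /\ 13 <= n - k) ->
   forall A : {set {vspace 'rV[F]_n}},
     A \subset subspaces _ k -> intersecting A ->
     diversity A <= diversity (G2 k X))
  /\
  (7 <= q -> 4 <= k -> 2 * k + 2 <= n ->
   forall A : {set {vspace 'rV[F]_n}},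
     A \subset subspaces _ k -> intersecting A ->
     (forall Y : {vspace 'rV[F]_n}, \dim Y = 3 -> ~ (A \subset G2 k Y)) ->
     ((diversity A)%:R <= 2%:R * q%:R^-1 * (diversity (G2 k X))%:R :> rat)%R).
Proof.
subst q; split=> [cases|q7 k4 kn] A Ak /intersectingP mA; last first.
  move=> notG2.
  have kn' : k + 2 <= n by lia.
  pose bound := #|F| ^ 2 * (thru F n 2 k - thru F n 3 k).
  apply: le_trans (_ : (_ <= 2%:R * #|F|%:R^-1 * bound%:R)%R) _.
    apply: le_trans (loss_q7 kn' k4 kn q7); rewrite ler_nat.
    by apply: diversity_not_in_G2 => //; lia.
  by rewrite ler_wpM2l ?mulr_ge0 ?invr_ge0 // ler_nat diversity_G2_ge //; lia.
have kcases : [\/ k = 1, k = 2, k = 3 | 4 <= k].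
  by case: k hk {cases Ak} => [|[|[|[|k]]]] // _;
    [constructor 1 | constructor 2 | constructor 3 | constructor 4].
case: kcases => [k1|k2|k3|k4].
- by subst k; rewrite (diversity_points hn Ak mA).
- subst k; apply: leq_trans (diversity_lines hn Ak mA) (diversity_G2_ge hX _ _); lia.
- subst k; apply: leq_trans (diversity_planes _ Ak mA) (diversity_G2_ge hX _ _); lia.
have kn : k + 2 <= n by lia.
apply: (diversity_large k4 kn Ak mA hX).
case: cases => [[]|[[]|[|[|[|[|]]]]]]; try lia.
- by case=> q5 [_ nk]; apply: loss_q5.
- by case=> q4 [k6 nk]; apply: loss_q4.
- by case=> q3 [k9 nk]; apply: loss_q3_k9.
- by case=> q3 [nk _]; apply: loss_q3.
- by case=> q2 [_ [nk nk13]]; apply: loss_q2.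
Qed.
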